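(* Let $p$ be an odd prime. For every $k\ge0$, $$W_k=\sum_{m=0}^{\lfloor k/(p-1)\rfloor}\delta_p(m)\,\rho_p\bigl(k-m(p-1)\bigr)\qquad\text{in }\mathbf F_p.$$ Moreover, if $m\ge1$ and $m-1=\alpha_0+\alpha_1p+\alpha_2p^2+\cdots$ with $0\le\alpha_i<p$, then $$\delta_p(m)=-\binom{p-1}{\alpha_0}\binom{\alpha_0}{\alpha_1}\binom{\alpha_1}{\alpha_2}\cdots\qquad\text{in }\mathbf F_p.$$ In particular, $\delta_p(m)=0$ unless $\alpha_0\ge\alpha_1\ge\alpha_2\ge\cdots$.
   Context: $p$ is an odd prime. The Artin--Hasse exponential is $\operatorname{AH}_p(X)=\exp\left(\sum_{i\ge0}X^{p^i}/p^i\right)=\sum_{n\ge0}u_nX^n\in\mathbf Z_p[[X]]$, $a_n\in\mathbf F_p$ is the reduction of $u_n$ modulo $p$, and $W_k=\sum_{r=0}^k(-1)^r r\,a_{rp}a_{(k-r)p}\in\mathbf F_p$. Let $w_p=\frac{(p-1)!+1}{p}\bmod p$ and let $B_n$ be the Bernoulli numbers with $B_1=-1/2$ (reduced modulo $p$ for $1\le n\le p-2$). Define in $\mathbf F_p$: $\lambda_1=w_p$ and $\lambda_d=B_{p-d}/d$ for $2\le d\le p-1$. For an integer $n\ge0$ with base-$p$ expansion $n=\sum_{i\ge0}d_i(n)p^i$, $0\le d_i(n)<p$, put $s_p(n)=\sum_i d_i(n)$ and $f_p(n)=\prod_i d_i(n)!\in\mathbf F_p^\times$. Set $\rho_p(0)=0$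 and, for $n>0$, $$\rho_p(n)=\begin{cases}\lambda_{s_p(n)}\,s_p(n)!/f_p(n),&1\le s_p(n)\le p-1,\\ -1/f_p(n),&s_p(n)=p,\\ 0,&s_p(n)>p.\end{cases}$$ Set $\delta_p(0)=1$ and $\delta_p(m)=-\binom{pm-1}{m-1}\bmod p\in\mathbf F_p$ for $m\ge1$. Binomial coefficients $\binom{a}{b}$ with $0\le a<b$ are $0$. *)

(* Defs.v *)
From mathcomp Require Import all_boot all_order all_algebra.

Set Implicit Arguments.
Unset Strict Implicit.
Unset Printing Implicit Defensive.

Import Order.TTheory GRing.Theory Num.Theory.
Local Open Scope ring_scope.

(* A formal power series over rat is given by its coefficients nat -> rat.    *)
(* If f 0 = 0 then f ^+ j has no term of degree < j, so only j <= n and the   *)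
(* coefficients of f of index <= n contribute to degree n of exp f.           *)
Definition fps_exp (f : nat -> rat) (n : nat) : rat :=
  \sum_(j < n.+1) ((\poly_(i < n.+1) f i) ^+ j)`_n / (j`!)%:R.

(* Coefficient of X^n in sum_i X^(p^i) / p^i; for p > 1, p ^ i = n forces     *)
(* i < n, so the range of i loses nothing.                                    *)
Definition AHlog (p n : nat) : rat :=
  \sum_(i < n.+1 | (p ^ i)%N == n) (p%:R ^+ i)^-1.

Definition AHcoef (p n : nat) : rat := fps_exp (AHlog p) n.

(* For r with denominator prime to p, [ratr r : 'F_p] is the reduction of r   *)
(* modulo p.  The coefficients of AH_p, and the Bernoulli numbers of index    *)
(* 1 <= n <= p - 2, are p-integral rationals (elements of Q inside Z_p).      *)
Definition a_ (p n : nat) : 'F_p := ratr (AHcoef p n).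

Definition W_ (p k : nat) : 'F_p :=
  \sum_(r < k.+1)
     (-1) ^+ r * (r : nat)%:R * a_ p (r * p)%N * a_ p ((k - r) * p)%N.

(* The division is exact for p prime, by Wilson's theorem.                    *)
Definition wilson_quotient (p : nat) : 'F_p :=
  ((((p - 1)`! + 1) %/ p)%N)%:R.

(* The first n Bernoulli numbers, with B_1 = -1/2; see bernoulli_rec.         *)
Fixpoint bernoulli_seq (n : nat) : seq rat :=
  if n is m.+1 then
    let s := bernoulli_seq m in
    rcons s (((m == 0%N)%:R - \sum_(j < m) 'C(m.+1, j)%:R * s`_j) / m.+1%:R)
  else [::].

Definition bernoulli (n : nat) : rat := (bernoulli_seq n.+1)`_n.

Lemma size_bernoulli_seq n : size (bernoulli_seq n) = n.
Proof. by elim: n => //= n IHn; rewrite size_rcons IHn. Qed.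

Lemma nth_bernoulli_seq n i : (i < n)%N -> (bernoulli_seq n)`_i = bernoulli i.
Proof.
elim: n => // n IHn; rewrite ltnS leq_eqVlt => /orP[/eqP -> //|lt_in].
by rewrite /= nth_rcons size_bernoulli_seq lt_in IHn.
Qed.

Lemma bernoulli_rec n :
  \sum_(j < n.+1) 'C(n.+1, j)%:R * bernoulli j = (n == 0%N)%:R.
Proof.
rewrite big_ord_recr /= binSn {2}/bernoulli /= nth_rcons size_bernoulli_seq.
rewrite ltnn eqxx mulrCA divff ?pnatr_eq0 // mulr1 addrC.
rewrite (eq_bigr (fun j : 'I_n => 'C(n.+1, j)%:R * bernoulli j)) ?subrK //.
by move=> j _; rewrite nth_bernoulli_seq.
Qed.

(* Only meaningful for 1 <= d <= p - 1.                                       *)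
Definition lambda_ (p d : nat) : 'F_p :=
  if d == 1%N then wilson_quotient p else ratr (bernoulli (p - d)) / d%:R.

Definition digit (p n i : nat) : nat := (n %/ p ^ i) %% p.

(* For p > 1 the digits of n of index i > n vanish, since n < p ^ i.          *)
Definition digit_sum (p n : nat) : nat := (\sum_(i < n.+1) digit p n i)%N.

Definition digit_fact (p n : nat) : 'F_p :=
  \prod_(i < n.+1) ((digit p n i)`!)%:R.

Definition rho_ (p n : nat) : 'F_p :=
  let s := digit_sum p n in
  if n == 0%N then 0
  else if (1 <= s <= p - 1)%N then lambda_ p s * (s`!)%:R / digit_fact p n
  else if s == p then - 1 / digit_fact p n
  else 0.

Definition delta_ (p m : nat) : 'F_p :=
  if m == 0%N then 1 else - 'C(p * m - 1, m - 1)%:R.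

(* Main.v *)
Require Import Defs.
From HB Require Import structures.
From mathcomp Require Import all_boot all_order all_algebra.
From mathcomp Require Import boolp finfield.
From mathcomp Require Import ring lra zify.

Set Implicit Arguments.
Unset Strict Implicit.
Unset Printing Implicit Defensive.

Import Order.TTheory GRing.Theory Num.Theory.
Local Open Scope ring_scope.

(** Write E(x) = sum_n u_n x^n for the Artin-Hasse exponential,
    S(t) = sum_i t^(p^i) and theta = t d/dt, so that theta E = S E. The
    coefficients u_n are p-integral by Dwork's criterion ([AH_pint]), and the
    theorem is about the section U_0(t) = sum_n u_(pn) t^n modulo p.

    Let U_j(t) = sum_n u_(pn+j) t^n for 0 <= j < p. Since S(x) = x + S(x^p),
    taking residues in theta E = S E gives
      (j - S + p theta) U_j = U_(j-1)  for 0 < j < p,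
      (0 - S + p theta) U_0 = t U_(p-1).
    Let A_j be the reduction of U_j modulo p, and V = A_(p-1). Modulo p these
    relations make every A_j a product of factors i - S times V; in particular
    A_0 = (S^(p-1) - 1) V. The symmetry E(x) E(-x) = 1, valid because p is odd,
    then becomes V(t) V(-t) (1 - S^(p-1)) = 1 ([AH_sec_last_fneg]).

    The derivative of V is invisible modulo p and is read off modulo p^2.
    Composing the p relations, the operator prod_(0 <= i < p) (i - S + p theta)
    sends U_(p-1) to t U_(p-1). With P(y) = prod_i (i - y), its first order
    expansion in p is P(S) - p P'(S) theta, up to a term in P''/2 that vanishes
    modulo p ([first_order_expansion]). Over the p-integral rationals write
    -P(y) = y^p - y + p G(y) and S^p = S(t^p) + p D. Then
    P(S) = t - p (D + G(S)), and dividing by p gives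
      theta V = - (D + G(S)) V   in F_p[[t]]  ([theta_AH_sec_last]).
    The generating series of W is A_0 theta(A_0(-t)), and these facts turn it
    into (1 - S^(p-1)) (D + G(S)) ([W_series]).

    It remains to expand the two factors. In F_p[[t]], S = t + S^p, and Lagrange
    inversion gives 1 - S^(p-1) = sum_m delta(m) t^((p-1)m) ([one_sub_Spow]).
    For d < p the coefficient of t^n in S^d is the multinomial d!/f_p(n) if
    s_p(n) = d and 0 otherwise, while D is the part of S^p lost in reduction and
    lives on s_p(n) = p. The coefficients of G are Stirling numbers divided by
    p: the linear one is the Wilson quotient, and the identity
    x (F(x) - F(x-1)) = p F(x) for the falling factorial F = -P forces on the
    others the recursion of the Bernoulli numbers ([falling_quo_lambda]). So
    D + G(S) = sum_n rho(n) t^n.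

    The second part of the theorem is Lucas' congruence for the base p
    expansions of pm - 1 and m - 1, whose digits differ by one shift. *)

(** * The ring of formal power series *)

(** A record rather than a bare function type, so that the convolution product
    does not compete with the pointwise one. *)
Record fps (R : Type) := Fps { fcoef : nat -> R }.
Coercion fcoef : fps >-> Funclass.

Lemma fpsP (R : Type) (f g : fps R) : (forall n, f n = g n) -> f = g.
Proof. by case: f g => [f] [g] /= /funext ->. Qed.

HB.instance Definition _ (R : Type) := gen_eqMixin (fps R).
HB.instance Definition _ (R : Type) := gen_choiceMixin (fps R).

Section FpsRing.
Variable R : comNzRingType.
Implicit Types f g h : fps R.

Definition ftrunc N f : {poly R} := \poly_(i < N) f i.

Definition fzero := Fps (fun _ => 0 : R).
Definition fone := Fps (fun n => (n == 0%N)%:R : R).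
Definition fopp f := Fps (fun n => - f n).
Definition fadd f g := Fps (fun n => f n + g n).
(* Locked, so that simplification leaves coefficients of products folded. *)
Definition fmul f g := locked (Fps (fun n => \sum_(i < n.+1) f i * g (n - i)%N)).

Lemma fmulE f g n : fmul f g n = \sum_(i < n.+1) f i * g (n - i)%N.
Proof. by rewrite /fmul -lock. Qed.

Lemma faddA : associative fadd.
Proof. by move=> f g h; apply: fpsP => n /=; rewrite addrA. Qed.
Lemma faddC : commutative fadd.
Proof. by move=> f g; apply: fpsP => n /=; rewrite addrC. Qed.
Lemma fadd0 : left_id fzero fadd.
Proof. by move=> f; apply: fpsP => n /=; rewrite add0r. Qed.
Lemma faddN : left_inverse fzero fopp fadd.
Proof. by move=> f; apply: fpsP => n /=; rewrite addNr. Qed.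

HB.instance Definition _ := GRing.isZmodule.Build (fps R) faddA faddC fadd0 faddN.

Lemma eq_coefM (a a' b b' : {poly R}) n :
  (forall i, (i <= n)%N -> a`_i = a'`_i) -> (forall i, (i <= n)%N -> b`_i = b'`_i) ->
  (a * b)`_n = (a' * b')`_n.
Proof.
move=> ha hb; rewrite !coefM; apply: eq_bigr => i _.
by rewrite ha ?hb ?leq_subr // -ltnS.
Qed.

(** Coefficients of products are those of products of truncations, which
    transfers the ring laws of polynomials to series. *)
Lemma fmul_trunc N n f g :
  (n < N)%N -> fmul f g n = (ftrunc N f * ftrunc N g)`_n.
Proof.
move=> ltnN; rewrite fmulE coefM; apply: eq_bigr => i _.
by rewrite !coef_poly (leq_trans (ltn_ord i)) ?(leq_ltn_trans (leq_subr _ _)).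
Qed.

Lemma fmulC : commutative fmul.
Proof.
by move=> f g; apply: fpsP => n; rewrite !(@fmul_trunc n.+1) // mulrC.
Qed.

Lemma fmulA : associative fmul.
Proof.
move=> f g h; apply: fpsP => n; rewrite !(@fmul_trunc n.+1) //.
rewrite (@eq_coefM _ (ftrunc n.+1 f) _ (ftrunc n.+1 g * ftrunc n.+1 h)) //; last first.
  by move=> i lein; rewrite coef_poly ltnS lein (@fmul_trunc n.+1).
rewrite mulrA; apply: eq_coefM => // i lein.
by rewrite [RHS]coef_poly ltnS lein (@fmul_trunc n.+1).
Qed.

Lemma fmul1 : left_id fone fmul.
Proof.
move=> f; apply: fpsP => n; rewrite fmulE big_ord_recl /= mul1r subn0.
by rewrite big1 ?addr0 // => i _; rewrite mul0r.
Qed.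

Lemma fmulDl : left_distributive fmul fadd.
Proof.
move=> f g h; apply: fpsP => n; rewrite [RHS]/= !fmulE -big_split /=.
by apply: eq_bigr => i _; rewrite mulrDl.
Qed.

Lemma fone_neq0 : fone != fzero.
Proof.
apply/negP => /eqP /(congr1 (fun f => fcoef f 0%N)) /= /eqP.
by rewrite oner_eq0.
Qed.

HB.instance Definition _ :=
  GRing.Zmodule_isComNzRing.Build (fps R) fmulA fmulC fmul1 fmulDl fone_neq0.

Lemma fcoefD f g n : (f + g) n = f n + g n. Proof. by []. Qed.
Lemma fcoefN f n : (- f) n = - f n. Proof. by []. Qed.
Lemma fcoef1 n : (1 : fps R) n = (n == 0%N)%:R. Proof. by []. Qed.
Lemma fcoefM f g n : (f * g) n = \sum_(i < n.+1) f i * g (n - i)%N.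
Proof. exact: fmulE. Qed.

Lemma fcoef_sum I (r : seq I) (P : pred I) (F : I -> fps R) n :
  (\sum_(i <- r | P i) F i) n = \sum_(i <- r | P i) F i n.
Proof. by elim/big_rec2: _ => // i x y _ <-. Qed.

Lemma fcoefMn f k n : (f *+ k) n = f n *+ k.
Proof. by elim: k => [|k IHk]; rewrite ?mulr0n // !mulrS fcoefD IHk. Qed.

Lemma fcoef_natM k f n : (k%:R * f) n = k%:R * f n.
Proof. by rewrite !mulr_natl fcoefMn. Qed.

Lemma fcoefMz f k n : (f *~ k) n = f n *~ k.
Proof. by case: k => k; rewrite /= -?NegzE ?mulrNz ?fcoefN fcoefMn. Qed.

(** Relates powers of series to the polynomial truncations in the definition of
    the exponential. *)
Lemma fcoefX_trunc N n f j : (n < N)%N -> (f ^+ j) n = (ftrunc N f ^+ j)`_n.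
Proof.
elim: j n => [|j IHj] n ltnN; first by rewrite !expr0 coef1.
rewrite !exprS (@fmul_trunc N) //; apply: eq_coefM => // i lein.
by rewrite coef_poly (leq_ltn_trans lein) // IHj // (leq_ltn_trans lein).
Qed.

Definition fX : fps R := Fps (fun n => (n == 1%N)%:R).

Lemma fcoefXnM k f n : (fX ^+ k * f) n = if (k <= n)%N then f (n - k)%N else 0.
Proof.
elim: k n => [|k IHk] n; first by rewrite mul1r subn0.
rewrite exprS -mulrA fcoefM big_ord_recl /= mul0r add0r.
case: n => [|n]; first by rewrite big_ord0.
rewrite big_ord_recl /= mul1r big1 ?addr0 => [|i _]; last by rewrite /= mul0r.
by rewrite IHk !subSS subn0 ltnS.
Qed.

Lemma fcoefXM f n : (fX * f) n = if n is m.+1 then f m else 0.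
Proof. by rewrite -[fX]expr1 fcoefXnM; case: n => //= n; rewrite subn1. Qed.

Lemma fcoefXn k n : (fX ^+ k) n = (n == k)%:R.
Proof.
rewrite -[_ ^+ k]mulr1 fcoefXnM fcoef1; case: leqP => [lekn|ltnk].
  by rewrite subn_eq0 eqn_leq lekn andbT.
by rewrite ltn_eqF.
Qed.

(** The derivation t d/dt, preferred to d/dt because it preserves degrees. *)
Definition theta f : fps R := Fps (fun n => n%:R * f n).

Lemma theta_is_additive : zmod_morphism theta.
Proof. by move=> f g; apply: fpsP => n; rewrite /= mulrBr. Qed.
HB.instance Definition _ := GRing.isZmodMorphism.Build _ _ theta theta_is_additive.

Lemma thetaM f g : theta (f * g) = theta f * g + f * theta g.
Proof.
apply: fpsP => n; rewrite /= !fcoefM mulr_sumr -big_split; apply: eq_bigr => i _ /=.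
have -> : n%:R = i%:R + (n - i)%N%:R :> R by rewrite -natrD subnKC // -ltnS.
by ring.
Qed.

Lemma theta1 : theta 1 = 0.
Proof. by apply: fpsP => [[|n]] /=; rewrite ?mul0r ?mulr0. Qed.

Lemma thetaXn f k : theta (f ^+ k) = k%:R * f ^+ k.-1 * theta f.
Proof.
elim: k => [|[|k] IHk]; first by rewrite theta1 !mul0r.
  by rewrite expr1 expr0 !mul1r.
by rewrite exprS thetaM IHk /= -natr1 exprS; ring.
Qed.

Lemma thetaX : theta fX = fX.
Proof. by apply: fpsP => [[|[|n]]]; rewrite /= ?mul1r ?mulr0. Qed.

(** The substitution t -> -t. *)
Definition fneg f : fps R := Fps (fun n => (-1) ^+ n * f n).

Lemma fneg_is_additive : zmod_morphism fneg.
Proof. by move=> f g; apply: fpsP => n; rewrite /= mulrBr. Qed.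
HB.instance Definition _ := GRing.isZmodMorphism.Build _ _ fneg fneg_is_additive.

Lemma fneg_is_monoid : monoid_morphism fneg.
Proof.
split; first by apply: fpsP => [[|n]]; rewrite /= ?mul1r ?mulr0.
move=> f g; apply: fpsP => n; rewrite /= !fcoefM mulr_sumr; apply: eq_bigr => i _ /=.
have -> : (-1) ^+ n = (-1) ^+ i * (-1) ^+ (n - i) :> R by rewrite -exprD subnKC // -ltnS.
by ring.
Qed.
HB.instance Definition _ := GRing.isMonoidMorphism.Build _ _ fneg fneg_is_monoid.

Lemma theta_fneg f : theta (fneg f) = fneg (theta f).
Proof. by apply: fpsP => n /=; ring. Qed.

End FpsRing.

Arguments fX {R}.

Section Dilate.
Variable R : comNzRingType.
Implicit Types f g : fps R.

(** The substitution t -> t^q. *)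
Definition fdil (q : nat) f : fps R := Fps (fun n => if (q %| n)%N then f (n %/ q)%N else 0).

Lemma fdil_is_additive q : zmod_morphism (fdil q).
Proof. by move=> f g; apply: fpsP => n /=; case: ifP => // _; rewrite subr0. Qed.
HB.instance Definition _ q := GRing.isZmodMorphism.Build _ _ (fdil q) (fdil_is_additive q).

Lemma fcoef_dilM q f g n : (0 < q)%N ->
  (fdil q f * g) n = \sum_(m < (n %/ q).+1) f m * g (n - m * q)%N.
Proof.
move=> q_gt0; rewrite fcoefM -(big_mkord xpredT (fun i => fdil q f i * g (n - i)%N)).
rewrite -(big_mkord xpredT (fun m => f m * g (n - m * q)%N)).
transitivity (\sum_(0 <= i < n.+1 | (q %| i)%N) f (i %/ q)%N * g (n - i)%N).
  rewrite [RHS]big_mkcond /=; apply: eq_bigr => i _; case: ifP => //.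
  by rewrite mul0r.
rewrite -[LHS]big_filter; have -> : filter (dvdn q) (index_iota 0 n.+1) =
    [seq (m * q)%N | m <- index_iota 0 (n %/ q).+1].
  apply: (@sorted_eq _ ltn); [exact: ltn_trans| by move=> x y; lia | | |].
  - by apply: sorted_filter; [exact: ltn_trans | rewrite /index_iota iota_ltn_sorted].
  - rewrite sorted_map; apply: sub_sorted (iota_ltn_sorted _ _) => x y /=.
    by rewrite ltn_pmul2r.
  apply: uniq_perm; first by rewrite filter_uniq ?iota_uniq.
    rewrite map_inj_uniq ?iota_uniq // => x y /eqP.
    by rewrite eqn_pmul2r // => /eqP.
  move=> i; rewrite mem_filter mem_index_iota ltnS.
  apply/idP/idP => [/andP[/dvdnP[m ->] le]|/mapP[m]].
    by apply: (map_f (fun m => m * q)%N); rewrite mem_index_iota /= ltnS leq_divRL.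
  by rewrite mem_index_iota /= ltnS leq_divRL // => le ->; rewrite dvdn_mull.
by rewrite big_map; apply: eq_bigr => m _; rewrite mulnK.
Qed.

Lemma fcoef_dil_mul q f n : (0 < q)%N -> fdil q f (n * q)%N = f n.
Proof. by move=> q0 /=; rewrite dvdn_mull // mulnK. Qed.

Lemma fdil1 q : fdil q 1 = 1 :> fps R.
Proof.
apply: fpsP => n /=; case: ifP => [/dvdnP[m ->]|].
  case: q => [|q]; first by rewrite muln0 divn0.
  by rewrite mulnK // muln_eq0 orbF.
by case: n => //; rewrite dvdn0.
Qed.

Lemma fdilM q f g : (0 < q)%N -> fdil q (f * g) = fdil q f * fdil q g.
Proof.
move=> q_gt0; apply: fpsP => n; rewrite fcoef_dilM //= fcoefM; case: ifP => [/dvdnP[m ->]|ndvd].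
  rewrite mulnK //; apply: eq_bigr => i _.
  by rewrite -mulnBl dvdn_mull // mulnK.
rewrite big1 // => i _; rewrite /= dvdn_subl ?dvdn_mull ?ndvd ?mulr0 //.
by rewrite -leq_divRL // -ltnS.
Qed.

Lemma fdilXn q f k : (0 < q)%N -> fdil q (f ^+ k) = fdil q f ^+ k.
Proof.
by move=> q0; elim: k => [|k IHk]; rewrite ?fdil1 // !exprS fdilM // IHk.
Qed.

Lemma theta_fdil q f : theta (fdil q f) = q%:R * fdil q (theta f).
Proof.
apply: fpsP => n; rewrite mulr_natl fcoefMn /=; case: ifP; last by rewrite mulr0 mul0rn.
by move=> dvd; rewrite -[in n%:R](divnK dvd) natrM mulrAC mulr_natr.
Qed.

Lemma fdilX q : (0 < q)%N -> fdil q fX = fX ^+ q :> fps R.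
Proof.
move=> q0; apply: fpsP => n; rewrite fcoefXn /=; case: ifP => [/dvdnP[m ->]|nd].
  by rewrite mulnK // -(eqn_pmul2r q0) mul1n.
by case: eqP nd => // ->; rewrite dvdnn.
Qed.

End Dilate.

Section Map.
Variables (R R' : comNzRingType) (phi : {rmorphism R -> R'}).

Definition fmap (f : fps R) : fps R' := Fps (fun n => phi (f n)).

Lemma fmap_is_additive : zmod_morphism fmap.
Proof. by move=> f g; apply: fpsP => n; rewrite /= rmorphB. Qed.
HB.instance Definition _ := GRing.isZmodMorphism.Build _ _ fmap fmap_is_additive.

Lemma fmap_is_monoid : monoid_morphism fmap.
Proof.
split; first by apply: fpsP => n; rewrite /= rmorph_nat.
by move=> f g; apply: fpsP => n; rewrite /= !fcoefM rmorph_sum; apply: eq_bigr => i _; rewrite rmorphM.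
Qed.
HB.instance Definition _ := GRing.isMonoidMorphism.Build _ _ fmap fmap_is_monoid.

Lemma fmapX : fmap fX = fX.
Proof. by apply: fpsP => n; rewrite /= rmorph_nat. Qed.

Lemma fmap_theta f : fmap (theta f) = theta (fmap f).
Proof. by apply: fpsP => n; rewrite /= rmorphM rmorph_nat. Qed.

Lemma fmap_fneg f : fmap (fneg f) = fneg (fmap f).
Proof. by apply: fpsP => n; rewrite /= rmorphM rmorphXn rmorphN1. Qed.

Lemma fmap_fdil q f : fmap (fdil q f) = fdil q (fmap f).
Proof. by apply: fpsP => n /=; case: ifP => // _; rewrite rmorph0. Qed.

End Map.

(** * Rationals with denominator prime to p *)

(** Stating integrality through the denominator makes the predicate decidable,
    as needed for a subring type. *)
Definition pint (p : nat) : {pred rat} := fun x => coprime p `|denq x|.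

(** Any denominator prime to p witnesses integrality, since the reduced one
    divides it. *)
Lemma pint_frac p (x : rat) (d : nat) (z : int) :
  coprime p d -> x * d%:R = z%:~R -> x \in pint p.
Proof.
case: (posnP d) => [->|d_gt0 cop_pd xd].
  by rewrite /coprime gcdn0 => /eqP -> _; rewrite /in_mem /= /pint coprime1n.
have xE : x = z%:Q / d%:Z%:Q by rewrite -xd mulfK // pnatr_eq0 -lt0n.
have [dz dzE] : exists dz : int, dz = d%:Z by exists d%:Z.
have {cop_pd} : coprime p `|dz| by rewrite dzE.
rewrite /in_mem /= /pint xE -dzE; case: (divqP z dz) => [_|k fx k_neq0].
  by rewrite /coprime (denq_int 0) gcdn1.
by rewrite abszM; apply: coprime_dvdr; rewrite dvdn_mull.
Qed.

Lemma mulr_denq (x : rat) : x * `|denq x|%N%:R = (numq x)%:~R.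
Proof. by rewrite numqE -[in RHS]absz_denq. Qed.

Lemma pint_subring p : subring_closed (pint p).
Proof.
split.
- by apply: (@pint_frac _ _ 1 1); rewrite ?coprimen1.
- move=> x y hx hy; apply: (@pint_frac _ _ (`|denq x| * `|denq y|)
      (numq x * `|denq y|%N%:Z - numq y * `|denq x|%N%:Z)).
    by rewrite coprimeMr; apply/andP.
  by rewrite natrM rmorphB !rmorphM /= -!mulr_denq -!pmulrn; ring.
- move=> x y hx hy; apply: (@pint_frac _ _ (`|denq x| * `|denq y|) (numq x * numq y)).
    by rewrite coprimeMr; apply/andP.
  by rewrite natrM rmorphM /= -!mulr_denq; ring.
Qed.

HB.instance Definition _ p :=
  GRing.isSubringClosed.Build rat (pint p) (pint_subring p).

Record Zp p := MkZp { zval :> rat; zvalP : zval \in pint p }.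
HB.instance Definition _ p := [isSub for @zval p].
HB.instance Definition _ p := [Choice of Zp p by <:].
HB.instance Definition _ p := [SubChoice_isSubComNzRing of Zp p by <:].

Lemma zval_natM p n (x : Zp p) : zval (n%:R * x) = n%:R * zval x.
Proof. by rewrite -[LHS]/(\val (n%:R * x)) rmorphM rmorph_nat. Qed.

Section Reduction.
Variables (p : nat) (p_prime : prime p).

Lemma natr_Fp_eq0 n : (n%:R == 0 :> 'F_p) = (p %| n)%N.
Proof. by rewrite (dvdn_pcharf (pchar_Fp p_prime)). Qed.

Lemma intr_Fp_eq0 z : (z%:~R == 0 :> 'F_p) = (p %| z)%Z.
Proof.
rewrite dvdzE absz_nat -natr_Fp_eq0; case: z => n //.
by rewrite NegzE mulrNz oppr_eq0 abszN.
Qed.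

Lemma denq_Fp_neq0 x : x \in pint p -> `|denq x|%N%:R != 0 :> 'F_p.
Proof. by rewrite natr_Fp_eq0 -prime_coprime. Qed.

(** The map [ratr] to F_p divides numerator by denominator in lowest terms; this
    computes it from an arbitrary fraction, as sums and products require. *)
Lemma ratr_FpM (x : rat) (d : nat) (z : int) :
  coprime p d -> x * d%:R = z%:~R -> ratr x * d%:R = z%:~R :> 'F_p.
Proof.
move=> cop xd; have /denq_Fp_neq0 nz : x \in pint p by apply: pint_frac xd.
have eqz : numq x * d%:Z = z * `|denq x|%N%:Z.
  apply: (@intr_inj rat); rewrite !rmorphM /= -mulr_denq -xd -!pmulrn; ring.
have := congr1 (fun z : int => z%:~R : 'F_p) eqz; rewrite !rmorphM /= => eqF.
apply: (mulIf nz); rewrite -eqF /ratr.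
rewrite -(absz_denq x) -!pmulrn mulrAC; congr (_ * _); exact: divfK.
Qed.

Definition red (_ : prime p) (x : Zp p) : 'F_p := ratr (val x).

Lemma redM_denq (x : Zp p) : red p_prime x * `|denq (val x)|%N%:R = (numq (val x))%:~R.
Proof. by apply: ratr_FpM; [exact: (valP x) | exact: mulr_denq]. Qed.

Lemma red_is_additive : zmod_morphism (red p_prime).
Proof.
move=> x y; have nx := denq_Fp_neq0 (valP x); have ny := denq_Fp_neq0 (valP y).
apply: (mulIf (mulf_neq0 nx ny)).
transitivity ((numq (val x))%:~R * `|denq (val y)|%N%:R
   - (numq (val y))%:~R * `|denq (val x)|%N%:R : 'F_p); last first.
  by rewrite -!redM_denq; ring.
have := @ratr_FpM (val (x - y)) (`|denq (val x)| * `|denq (val y)|)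
      (numq (val x) * `|denq (val y)|%N%:Z - numq (val y) * `|denq (val x)|%N%:Z).
rewrite !natrM => ->.
- by rewrite rmorphB !rmorphM /= -!pmulrn.
- by rewrite coprimeMr; apply/andP; split; [exact: (valP x)|exact: (valP y)].
- by rewrite !(rmorphB, rmorphM) /= -!mulr_denq -!pmulrn; ring.
Qed.
HB.instance Definition _ := GRing.isZmodMorphism.Build _ _ (red p_prime) red_is_additive.

Lemma red_is_monoid : monoid_morphism (red p_prime).
Proof.
split; first by rewrite /red rmorph1 (ratr_nat _ 1).
move=> x y; have nx := denq_Fp_neq0 (valP x); have ny := denq_Fp_neq0 (valP y).
apply: (mulIf (mulf_neq0 nx ny)).
transitivity ((numq (val x))%:~R * (numq (val y))%:~R : 'F_p); last first.
  by rewrite -!redM_denq; ring.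
have := @ratr_FpM (val (x * y)) (`|denq (val x)| * `|denq (val y)|)
      (numq (val x) * numq (val y)).
rewrite !natrM => ->.
- by rewrite rmorphM.
- by rewrite coprimeMr; apply/andP; split; [exact: (valP x)|exact: (valP y)].
- by rewrite !rmorphM /= -!mulr_denq; ring.
Qed.
HB.instance Definition _ := GRing.isMonoidMorphism.Build _ _ (red p_prime) red_is_monoid.

Lemma pint_divn (n : nat) : ~~ (p %| n)%N -> n%:R^-1 \in pint p.
Proof.
move=> nd; have n0 : n%:R != 0 :> rat by rewrite pnatr_eq0; case: n nd => //; rewrite dvdn0.
by apply: (@pint_frac _ _ n 1); rewrite ?prime_coprime // mulVf.
Qed.

Lemma pmul_inj : injective (fun x : Zp p => p%:R * x).
Proof.
move=> x y /(congr1 (@zval p)); rewrite !zval_natM => /mulfI h.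
by apply/val_inj/h; rewrite pnatr_eq0 -lt0n prime_gt0.
Qed.

Lemma red_eq0 x : red p_prime x = 0 -> exists y, x = p%:R * y.
Proof.
move=> rx; have := redM_denq x; rewrite rx mul0r => /esym/eqP.
rewrite intr_Fp_eq0 => /dvdzP[k kE].
have p0 : p%:R != 0 :> rat by rewrite pnatr_eq0 -lt0n prime_gt0.
have yP : val x / p%:R \in pint p.
  apply: (@pint_frac _ _ `|denq (val x)| k); first exact: (valP x).
  rewrite mulrAC mulr_denq kE rmorphM /= -pmulrn mulfK //.
exists (MkZp yP); apply: val_inj; by rewrite [RHS]zval_natM mulrC divfK.
Qed.

Lemma fpmul_inj : injective (fun f : fps (Zp p) => p%:R * f).
Proof.
move=> f g fg; apply: fpsP => n; apply: pmul_inj.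
by have := congr1 (fun h => fcoef h n) fg; rewrite !mulr_natl !fcoefMn.
Qed.

(** Congruences modulo p between integral series are turned into equations that
    can later be divided by p. *)
Lemma fmap_red_eq0 f : fmap (red p_prime) f = 0 -> exists g, f = p%:R * g.
Proof.
move=> f0; have /choice[g gP] : forall n, exists y, f n = p%:R * y.
  by move=> n; apply: red_eq0; have := congr1 (fun h => fcoef h n) f0.
by exists (Fps g); apply: fpsP => n; rewrite mulr_natl fcoefMn /= gP mulr_natl.
Qed.

End Reduction.

(** * Exponentials over the rationals *)

Lemma fcoefXn_small (R : comNzRingType) (f : fps R) j n :
  f 0%N = 0 -> (n < j)%N -> (f ^+ j) n = 0.
Proof.
move=> f0 ltnj; pose g := Fps (fun n => f n.+1).
have -> : f = fX * g by apply: fpsP => [[|m]]; rewrite fcoefXM.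
by rewrite exprMn fcoefXnM leqNgt ltnj.
Qed.

Section RatExp.
Implicit Types f g F G : fps rat.

(** In degree n the exponential sum may be cut anywhere beyond n, since f^j
    starts in degree j. *)
Lemma fps_expE f n M : f 0%N = 0 -> (n <= M)%N ->
  fps_exp f n = \sum_(j < M.+1) (f ^+ j) n / (j`!)%:R.
Proof.
move=> f0 lenM; rewrite /fps_exp.
rewrite -(subnKC lenM) -addSn big_split_ord /= [X in _ + X]big1 ?addr0.
  by apply: eq_bigr => j _; rewrite (@fcoefX_trunc _ n.+1).
by move=> j _; rewrite fcoefXn_small ?mul0r // ltn_addr.
Qed.

Definition fexp f : fps rat := Fps (fps_exp f).

Lemma fexp0 f : f 0%N = 0 -> fexp f 0%N = 1.
Proof. by move=> f0; rewrite /= (@fps_expE _ _ 0) // big_ord1 expr0 divr1. Qed.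

(** The exponential satisfies its differential equation: theta(f^(j+1))/(j+1)! =
    theta(f) f^j/j!, and the boundary term j = n has no coefficient in degree n.
    *)
Lemma theta_fexp f : f 0%N = 0 -> theta (fexp f) = theta f * fexp f.
Proof.
move=> f0; apply: fpsP => n.
have -> : theta (fexp f) n = \sum_(j < n.+1) theta (f ^+ j) n / (j`!)%:R.
  rewrite /= (@fps_expE _ _ n) // mulr_sumr; apply: eq_bigr => j _.
  by rewrite mulrA.
have -> : (theta f * fexp f) n = \sum_(j < n.+1) (theta f * f ^+ j) n / (j`!)%:R.
  rewrite fcoefM; under eq_bigr => i _.
    rewrite [fcoef (fexp f) _]/= (@fps_expE _ _ n) ?leq_subr // mulr_sumr; over.
  rewrite exchange_big; apply: eq_bigr => j _; rewrite fcoefM mulr_suml.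
  by apply: eq_bigr => i _; rewrite mulrA.
rewrite big_ord_recl [RHS]big_ord_recr [f ^+ ord0]expr0 theta1 mul0r add0r.
have thS j : theta (f ^+ j.+1) = j.+1%:R * (theta f * f ^+ j).
  by rewrite thetaXn /=; ring.
have -> : (theta f * f ^+ n) n = 0.
  have := congr1 (fun h => fcoef h n) (thS n).
  rewrite mulr_natl fcoefMn /= fcoefXn_small // mulr0 => /esym/eqP.
  by rewrite mulrn_eq0 /= => /eqP.
rewrite mul0r [RHS]/= addr0; apply: eq_bigr => j _.
rewrite -[fcoef (theta _) n]/(theta (f ^+ (lift ord0 j)) n) thS fcoef_natM.
by rewrite lift0 factS natrM invfM mulrACA divff ?mul1r // pnatr_eq0.
Qed.

(** In degree n the equation reads n F_n = terms of lower degree, so in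
    characteristic 0 the constant term determines F. *)
Lemma theta_ode_uniq F F' G : G 0%N = 0 -> F 0%N = F' 0%N ->
  theta F = G * F -> theta F' = G * F' -> F = F'.
Proof.
move=> G0 FF' hF hF'; apply: fpsP; elim/ltn_ind => -[//|n] IHn.
have nz : n.+1%:R != 0 :> rat by rewrite pnatr_eq0.
apply: (mulfI nz); rewrite -![_.+1%:R * _]/(theta _ n.+1) hF hF' !fcoefM.
rewrite big_ord_recl [RHS]big_ord_recl G0 !mul0r !add0r; apply: eq_bigr => i _.
by rewrite IHn // lift0 subSS ltnS leq_subr.
Qed.

End RatExp.

(** * The series of p-powers *)

Section PowerSeries.
Variables (R : comNzRingType) (p : nat) (p_gt1 : (1 < p)%N).

(** The series sum_i t^(p^i); as for the logarithm of the Artin-Hasse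
    exponential, p^i = n forces i <= n. *)
Definition Spow (R : comNzRingType) p : fps R :=
  Fps (fun n => \sum_(i < n.+1 | (p ^ i == n)%N) 1).

Lemma sum_pow_widen m N : (m < N)%N ->
  \sum_(i < N | (p ^ i == m)%N) 1 = \sum_(i < m.+1 | (p ^ i == m)%N) 1 :> R.
Proof.
move=> ltmN; rewrite -(subnKC ltmN) big_split_ord /= [X in _ + X]big_pred0 ?addr0 //.
move=> i; apply/negbTE; rewrite neq_ltn; apply/orP; right.
by apply: leq_trans (ltn_expl _ p_gt1); rewrite ltnS ltnW // ltnS leq_addr.
Qed.

Lemma SpowE : Spow R p = fX + fdil p (Spow R p).
Proof.
have p0 : (0 < p)%N by apply: ltnW.
apply: fpsP => n /=; rewrite big_mkcond big_ord_recl /= expn0 eq_sym.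
congr (_ + _); first by case: eqP.
rewrite -big_mkcond /=; case: ifP => [/dvdnP[m ->]|nd]; last first.
  rewrite big_pred0 // => i; apply/eqP => h; move: nd.
  by rewrite -h /bump leq0n add1n expnS dvdn_mulr.
rewrite mulnK // (eq_bigl (fun i : 'I_(m * p) => (p ^ i == m)%N)); last first.
  by move=> i; rewrite /bump leq0n add1n expnSr eqn_pmul2r.
case: (posnP m) => [->|m_gt0].
  by rewrite big_ord0 big_ord1_cond expn0.
by apply: sum_pow_widen; rewrite ltn_Pmulr.
Qed.

Lemma Spow0 : Spow R p 0%N = 0.
Proof. by rewrite /= big_ord1_cond expn0. Qed.

Lemma theta_Spow : theta (Spow R p) = fX + p%:R * fdil p (theta (Spow R p)).
Proof. by rewrite {1}SpowE raddfD /= thetaX theta_fdil. Qed.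

End PowerSeries.

Lemma fmap_Spow (R R' : comNzRingType) (phi : {rmorphism R -> R'}) p :
  fmap phi (Spow R p) = Spow R' p.
Proof.
apply: fpsP => n /=; rewrite rmorph_sum; apply: eq_bigr => i _.
exact: rmorph1.
Qed.

Lemma fneg_Spow (R : comNzRingType) p : odd p -> fneg (Spow R p) = - Spow R p.
Proof.
move=> p_odd; apply: fpsP => n /=; rewrite mulr_sumr -sumrN; apply: eq_bigr => i /eqP <-.
by rewrite -signr_odd oddX p_odd orbT expr1 mulN1r.
Qed.

Lemma theta_AHlog p : (1 < p)%N -> theta (Fps (AHlog p)) = Spow rat p.
Proof.
move=> p_gt1; apply: fpsP => n /=; rewrite /AHlog mulr_sumr.
apply: eq_bigr => i /eqP {1}<-; rewrite natrX divff //.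
by rewrite expf_neq0 // pnatr_eq0 -lt0n ltnW.
Qed.

Definition AH p : fps rat := Fps (AHcoef p).

Lemma AHlog0 p : AHlog p 0%N = 0.
Proof. by rewrite /AHlog big_ord1_cond expn0. Qed.

Lemma AH0 p : AH p 0%N = 1.
Proof. exact: (@fexp0 (Fps (AHlog p)) (AHlog0 p)). Qed.

Lemma theta_AH p : (1 < p)%N -> theta (AH p) = Spow rat p * AH p.
Proof.
move=> p_gt1; rewrite -theta_AHlog //.
exact: (@theta_fexp (Fps (AHlog p)) (AHlog0 p)).
Qed.

(** For odd p the series S is odd, so E(x) E(-x) has zero derivative. *)
Lemma AH_fneg p : (1 < p)%N -> odd p -> AH p * fneg (AH p) = 1.
Proof.
move=> p_gt1 p_odd; apply: (@theta_ode_uniq _ _ 0).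
- by [].
- by rewrite fcoefM big_ord1 AH0 mul1r -[LHS]/((-1) ^+ 0 * AH p 0%N) AH0 mulr1.
- rewrite thetaM theta_fneg theta_AH // rmorphM /= fneg_Spow //; ring.
- by rewrite theta1 mul0r.
Qed.

Definition expX (p : nat) : fps rat := Fps (fun n => p%:R ^+ n / (n`!)%:R).

Lemma theta_expX p : theta (expX p) = p%:R * fX * expX p.
Proof.
apply: fpsP => n; rewrite -mulrA fcoef_natM fcoefXM.
case: n => [|n]; first by rewrite /= mul0r mulr0.
rewrite /= factS natrM invfM mulrCA [X in _ * X]mulrA mulfV ?pnatr_eq0 // mul1r exprS.
by rewrite -mulrA.
Qed.

(** Dwork's functional equation E(x)^p = E(x^p) exp(px): both sides have
    logarithmic derivative p S(x) = p x + p S(x^p). *)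
Lemma AH_dwork p : (1 < p)%N -> AH p ^+ p = fdil p (AH p) * expX p.
Proof.
move=> p_gt1; have p0 := ltnW p_gt1.
apply: (@theta_ode_uniq _ _ (p%:R * Spow rat p)).
- by rewrite mulr_natl fcoefMn Spow0 mul0rn.
- rewrite fcoef_dilM // div0n big_ord1 AH0 mul1r [RHS]/= divr1.
  by rewrite (@fcoefX_trunc _ 1) // -horner_coef0 horner_exp horner_coef0 coef_poly AH0 expr1n.
- rewrite thetaXn theta_AH //; case: (p) p0 => // q _ /=; rewrite exprS; ring.
- rewrite thetaM theta_fdil theta_AH // fdilM // theta_expX {2}SpowE //; ring.
Qed.

(** * Integrality of the Artin--Hasse exponential *)

Section Prime.
Variables (p : nat) (p_prime : prime p).
Let p_gt0 : (0 < p)%N := prime_gt0 p_prime.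
Let p_gt1 : (1 < p)%N := prime_gt1 p_prime.
Notation redF := (fmap (red p_prime)).

Lemma fps_Fp_pchar : p%:R = 0 :> fps 'F_p.
Proof.
apply: fpsP => n; rewrite -[p%:R]mulr1 fcoef_natM.
by rewrite (pcharf0 (pchar_Fp p_prime)) mul0r.
Qed.

(** The Frobenius is additive and fixes the coefficients. *)
Lemma fps_Frobenius (f : fps 'F_p) : f ^+ p = fdil p f.
Proof.
apply: fpsP => n; rewrite (@fcoefX_trunc _ n.+1) // /ftrunc poly_def.
have chp : p \in [pchar {poly 'F_p}] by rewrite pchar_poly pchar_Fp.
rewrite -(pFrobenius_autE chp) rmorph_sum /= coef_sum.
under eq_bigr => i _.
  rewrite pFrobenius_autE exprZn -exprM coefZ coefXn.
  have -> : f i ^+ p = f i by have := expf_card (f i); rewrite card_Fp.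
  over.
case: ifP => [/dvdnP[m ->]|nd].
  rewrite mulnK //; have ltm : (m < (m * p).+1)%N by rewrite ltnS leq_pmulr.
  rewrite (bigD1 (Ordinal ltm)) //= eqxx mulr1 big1 ?addr0 // => i.
  by rewrite -val_eqE /= eqn_pmul2r // eq_sym => /negbTE ->; rewrite mulr0.
rewrite big1 // => i _; have -> : (n == i * p)%N = false; last by rewrite mulr0.
by apply: contraFF nd => /eqP ->; rewrite dvdn_mull.
Qed.

(** Legendre's formula: each quotient k/p^(i+1) is at most half of k/p^i, which
    bounds the sum strictly below k. *)
Lemma logn_fact_lt k : (0 < k)%N -> (logn p k`! < k)%N.
Proof.
rewrite logn_fact // => k_gt0.
suff: forall M k, (0 < k)%N -> (\sum_(1 <= i < M.+1) k %/ p ^ i < k)%N by apply.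
elim=> [|M IHM] {k_gt0}k k_gt0; first by rewrite big_geq.
rewrite big_nat_recl //= expn1.
under eq_bigr => i _ do rewrite expnS divnMA.
case: (posnP (k %/ p)) => [->|q_gt0].
  by rewrite big1 // => i _; rewrite div0n.
apply: (@leq_trans (k %/ p + k %/ p)); first by rewrite ltn_add2l IHM.
rewrite addnn -muln2; apply: leq_trans (leq_trunc_div k p).
by rewrite leq_mul2l p_gt1 orbT.
Qed.

Lemma expX_pint k : (0 < k)%N -> expX p k / p%:R \in pint p.
Proof.
move=> k_gt0; have [m cop_m kE] := pfactor_coprime p_prime (fact_gt0 k).
have lt := logn_fact_lt k_gt0.
have p0 : p%:R != 0 :> rat by rewrite pnatr_eq0 -lt0n.
have -> : expX p k / p%:R = p%:R ^+ (k - (logn p k`!).+1) * m%:R^-1.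
  rewrite /= {1}kE natrM invfM natrX -{1}(subnK lt) exprD exprS.
  have pe0 : p%:R ^+ logn p k`! != 0 :> rat by rewrite expf_neq0.
  have m0 : m%:R != 0 :> rat.
    by rewrite pnatr_eq0; apply: contraL cop_m => /eqP ->; rewrite /coprime gcdn0 gtn_eqF.
  by field; rewrite p0 m0 pe0.
by rewrite rpredM ?rpredX ?rpred_nat ?pint_divn // -prime_coprime.
Qed.

(** The linear term of the binomial expansion, with the remainder left as an
    unspecified multiple of b^2. *)
Lemma exprD_first_order (A : comNzRingType) (a b : A) n :
  exists c, (a + b) ^+ n = a ^+ n + n%:R * a ^+ n.-1 * b + b ^+ 2 * c.
Proof.
elim: n => [|[|n] [c IHn]]; first by exists 0; rewrite !expr0; ring.
  by exists 0; rewrite /= !expr1 expr0; ring.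
exists ((n.+1)%:R * a ^+ n + c * (a + b)); rewrite exprS {}IHn /= -!natr1 !exprS; ring.
Qed.

(** Dwork's criterion. If p does not divide n, use n u_n = sum_i u_(n-p^i). If n
    = pm, compare coefficients of x^n in E(x)^p = E(x^p) exp(px): with F the
    part of E below degree n, the left side is that of F(x)^p plus p u_n, and
    F(x)^p is F(x^p) modulo p; the right side is u_m modulo p because p^k/k! is
    divisible by p for k > 0. *)
Lemma AH_pint n : AH p n \in pint p.
Proof.
elim/ltn_ind: n => n IHn.
case: (posnP n) => [->|n_gt0]; first by rewrite AH0 rpred1.
have [/dvdnP[m nE]|ndvd] := boolP (p %| n)%N; last first.
  have n0 : n%:R != 0 :> rat by rewrite pnatr_eq0 -lt0n.
  have := congr1 (fun h => fcoef h n) (theta_AH p_gt1).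
  rewrite fcoefM big_ord_recl Spow0 mul0r add0r => E.
  rewrite -(mulKf n0 (AH p n)) rpredM ?pint_divn // [X in X \in _]E.
  apply: rpred_sum => i _; rewrite rpredM //.
    by rewrite rpred_sum // => j _; rewrite rpred1.
  by rewrite IHn // ltn_subrL lift0.
have m_gt0 : (0 < m)%N by move: n_gt0; rewrite nE muln_gt0 => /andP[].
have p0 : p%:R != 0 :> rat by rewrite pnatr_eq0 -lt0n.
(* Split E at degree n; only the lower part F is known to be integral. *)
pose F := Fps (fun i => if (i < n)%N then AH p i else 0).
pose G := Fps (fun i => AH p (n + i)%N).
have AHE : AH p = F + fX ^+ n * G.
  apply: fpsP => i; rewrite fcoefD fcoefXnM /= ltnNge.
  by case: leqP => h /=; rewrite ?addr0 ?add0r ?subnKC.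
have [Fz FzE] : exists Fz : fps (Zp p), forall i, zval (Fz i) = F i.
  have hF i : F i \in pint p by rewrite /=; case: ifP => [/IHn|] //; rewrite rpred0.
  by exists (Fps (fun i => MkZp (hF i))).
have [g gE] : exists g, Fz ^+ p - fdil p Fz = p%:R * g.
  apply: (@fmap_red_eq0 _ p_prime).
  by rewrite rmorphB rmorphXn /= fmap_fdil fps_Frobenius subrr.
pose zv : {rmorphism Zp p -> rat} := \val.
have FzF : fmap zv Fz = F by apply: fpsP => i; rewrite /= FzE.
have FpE : F ^+ p = fdil p F + p%:R * fmap zv g.
  have := congr1 (fmap zv) gE; rewrite rmorphB rmorphXn rmorphM rmorph_nat /=.
  by rewrite fmap_fdil FzF => <-; rewrite addrC subrK.
have F0 : F 0%N = 1 by rewrite /= n_gt0 -[LHS]/(AH p 0%N) AH0.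
have [c cE] := exprD_first_order F (fX ^+ n * G) p.
have L : (AH p ^+ p) n = AH p m + p%:R * zval (g n) + p%:R * AH p n.
  have Fm : F m = AH p m by rewrite [LHS]/= nE ltn_Pmulr.
  have G0 : G 0%N = AH p n by rewrite [LHS]/= addn0.
  rewrite [in LHS]AHE cE FpE -Fm -G0.
  have -> : (fX ^+ n * G) ^+ 2 * c = fX ^+ (n + n) * (G ^+ 2 * c).
    by rewrite exprMn -exprM muln2 -addnn mulrA.
  have -> : p%:R * F ^+ p.-1 * (fX ^+ n * G) = fX ^+ n * (p%:R * (F ^+ p.-1 * G)) by ring.
  have nn : (n + n <= n)%N = false by lia.
  rewrite !fcoefD !fcoefXnM nn leqnn subnn addr0 !fcoef_natM.
  have -> : fdil p F n = F m by rewrite nE fcoef_dil_mul.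
  have Fp0 : (F ^+ p.-1) 0%N = 1.
    by rewrite (@fcoefX_trunc _ 1) // -horner_coef0 horner_exp horner_coef0 coef_poly F0 expr1n.
  by rewrite fcoefM big_ord1 Fp0 mul1r.
(* The term i = m of the convolution has constant exponential factor 1; the
   others carry a factor p^k / k! with k > 0. *)
have Rr : (AH p ^+ p) n = AH p m +
    p%:R * \sum_(i < m) AH p i * (expX p (n - i * p)%N / p%:R).
  have nm : (n %/ p)%N = m by rewrite nE mulnK.
  rewrite AH_dwork // fcoef_dilM // nm big_ord_recr [LHS]addrC.
  congr (_ + _); first by rewrite /= -nE subnn expr0 fact0 divr1.
  by rewrite [RHS]mulr_sumr; apply: eq_bigr => i _ /=; rewrite [RHS]mulrCA [p%:R * _]mulrC divfK.
have -> : AH p n = \sum_(i < m) AH p i * (expX p (n - i * p)%N / p%:R) - zval (g n).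
  by apply: (mulfI p0); rewrite mulrBr; move: L; rewrite Rr; lra.
rewrite rpredB ?zvalP // rpred_sum // => i _; rewrite rpredM // ?IHn ?expX_pint //.
  by rewrite nE (leq_trans (ltn_ord i)) // leq_pmulr.
by rewrite subn_gt0 nE ltn_pmul2r.
Qed.

End Prime.

(** * Sections modulo p and the first order expansion *)

Section Sections.
Variables (R : comNzRingType) (p : nat) (p_gt0 : (0 < p)%N).
Implicit Types f g : fps R.

(** The section of f along the residue class of j modulo p. *)
Definition fsec (j : nat) f : fps R := Fps (fun n => f (n * p + j)%N).

Lemma fsecD j f g : fsec j (f + g) = fsec j f + fsec j g.
Proof. exact: fpsP. Qed.

Lemma fsec_theta j f : fsec j (theta f) = p%:R * theta (fsec j f) + j%:R * fsec j f.
Proof.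
apply: fpsP => n; rewrite fcoefD !fcoef_natM /= natrD natrM; ring.
Qed.

Lemma fsec_dilM j f g : (j < p)%N -> fsec j (fdil p f * g) = f * fsec j g.
Proof.
move=> ltjp; apply: fpsP => n; rewrite [LHS]/= fcoef_dilM // fcoefM.
rewrite divnMDl // divn_small // addn0; apply: eq_bigr => i _.
by rewrite /= mulnBl addnBAC // leq_mul2r -ltnS ltn_ord orbT.
Qed.

Lemma fsecXM j f : fsec j.+1 (fX * f) = fsec j f.
Proof. by apply: fpsP => n; rewrite /= addnS fcoefXM. Qed.

Lemma fsec0XM f : fsec 0 (fX * f) = fX * fsec p.-1 f.
Proof.
apply: fpsP => -[|n]; first by rewrite [LHS]/= !fcoefXM.
have np : (n.+1 * p + 0)%N = (n * p + p.-1).+1 by rewrite mulSn; lia.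
by rewrite -[LHS]/((fX * f) (n.+1 * p + 0)%N) np !fcoefXM.
Qed.

End Sections.

Section IntHorner.
Variables (A : comNzRingType) (s : A).

(** Integer polynomials are evaluated in an arbitrary commutative ring, so that
    one polynomial identity serves over the integers, over the p-integral
    rationals and modulo p. *)
Definition zhorner (P : {poly int}) : A := (map_poly intr P).[s].

Lemma zhornerM P Q : zhorner (P * Q) = zhorner P * zhorner Q.
Proof. by rewrite /zhorner rmorphM hornerM. Qed.
Lemma zhornerD P Q : zhorner (P + Q) = zhorner P + zhorner Q.
Proof. by rewrite /zhorner rmorphD hornerD. Qed.
Lemma zhornerN P : zhorner (- P) = - zhorner P.
Proof. by rewrite /zhorner rmorphN hornerN. Qed.
Lemma zhornerB P Q : zhorner (P - Q) = zhorner P - zhorner Q.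
Proof. by rewrite zhornerD zhornerN. Qed.
Lemma zhornerX : zhorner 'X = s.
Proof. by rewrite /zhorner map_polyX hornerX. Qed.
Lemma zhornerXn n : zhorner 'X^n = s ^+ n.
Proof. by rewrite /zhorner map_polyXn hornerXn. Qed.
Lemma zhorner_nat n : zhorner n%:R = n%:R.
Proof. by rewrite /zhorner rmorph_nat -polyC_natr hornerC. Qed.
Lemma zhorner1 : zhorner 1 = 1. Proof. exact: (zhorner_nat 1). Qed.
Lemma zhorner0 : zhorner 0 = 0. Proof. exact: (zhorner_nat 0). Qed.
Lemma zhornerE P : zhorner P = \sum_(i < size P) (P`_i)%:~R * s ^+ i.
Proof.
rewrite {1}/zhorner (@horner_coef_wide _ (size P)); last by rewrite size_poly.
by apply: eq_bigr => i _; rewrite coef_map.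
Qed.
Lemma zhorner_prod (I : Type) (r : seq I) (P : pred I) F :
  zhorner (\prod_(i <- r | P i) F i) = \prod_(i <- r | P i) zhorner (F i).
Proof. by elim/big_rec2: _ => [|i x y _ <-]; rewrite ?zhorner1 ?zhornerM. Qed.

Lemma zhorner_sum (I : Type) (r : seq I) (P : pred I) F :
  zhorner (\sum_(i <- r | P i) F i) = \sum_(i <- r | P i) zhorner (F i).
Proof. by elim/big_rec2: _ => [|i x y _ <-]; rewrite ?zhorner0 ?zhornerD. Qed.

End IntHorner.

Lemma rmorph_zhorner (A B : comNzRingType) (phi : {rmorphism A -> B}) s P :
  phi (zhorner s P) = zhorner (phi s) P.
Proof.
rewrite !zhornerE rmorph_sum; apply: eq_bigr => i _.
by rewrite rmorphM rmorphXn rmorph_int.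
Qed.

(** The Leibniz rule for an ordered product. *)
Lemma deriv_prod_nat (R : comNzRingType) (F : nat -> {poly R}) m n : (m <= n)%N ->
  (\prod_(m <= i < n) F i)^`() =
  \sum_(m <= j < n) \prod_(m <= i < j) F i * (F j)^`() * \prod_(j.+1 <= i < n) F i.
Proof.
move=> lemn; rewrite -(subnKC lemn); elim: (n - m)%N => [|d IHd].
  by rewrite addn0 !big_geq // derivC.
rewrite addnS big_nat_recr ?leq_addr // [RHS]big_nat_recr ?leq_addr //= derivM IHd.
rewrite [X in _ = _ + _ * X]big_geq // mulr1.
congr (_ + _); rewrite mulr_suml; apply: eq_big_nat => j /andP[_ ltj].
by rewrite [X in _ = _ * X]big_nat_recr // mulrA.
Qed.

Section FirstOrder.
Variables (R : comNzRingType).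
Implicit Types (S V f : fps R) (P : {poly int}).

Lemma theta_zhorner S P :
  theta (zhorner S P) = zhorner S P^`() * theta S.
Proof.
rewrite /zhorner; elim/poly_ind: P => [|P c IHP]; first by rewrite raddf0 deriv0 rmorph0 !horner0 raddf0 mul0r.
rewrite derivD derivM derivX derivC addr0 mulr1.
rewrite !rmorphD !rmorphM /= map_polyX map_polyC /=.
rewrite !hornerE /= raddfD /= thetaM IHP.
have ->: theta (c%:~R : fps R) = 0.
  by rewrite raddfMz /= theta1 mul0rz.
by ring.
Qed.

Lemma theta_natM n f : theta (n%:R * f) = n%:R * theta f.
Proof. by apply: fpsP => m; rewrite fcoef_natM [LHS]/= fcoef_natM [RHS]/= mulrCA. Qed.

(** Composing K operators a_k - S + p theta and keeping the terms of order at
    most 1 in p: theta either reaches T_0, and the sum of the products with one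
    factor missing is -P'(S), or it hits a factor to its right, and the products
    with two factors missing add up to half of P''. The polynomial Q stands for
    P''/2, which has integer coefficients but is only needed through Q + Q. *)
Lemma first_order_expansion (p K : nat) S (T : nat -> fps R) (a : nat -> nat) :
  (forall k, (k < K)%N -> T k.+1 = ((a k)%:R - S) * T k + p%:R * theta (T k)) ->
  let P := \prod_(i < K) ((a i)%:R - 'X) : {poly int} in
  exists Q E, Q + Q = P^`()^`() /\
   T K = zhorner S P * T 0%N - p%:R * (zhorner S P^`() * theta (T 0%N) + theta S * zhorner S Q * T 0%N)
          + p%:R ^+ 2 * E.
Proof.
elim: K => [|K IHK] TS /=.
  exists 0, 0; rewrite big_ord0 derivC deriv0 addr0 zhorner1 !zhorner0; split=> //; ring.
have [k ltk|Q [E [QE TK]]] := IHK; first by apply: TS; apply: ltnW.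
rewrite big_ord_recr /=; set P := \prod_(i < K) _ in Q TK QE *.
have derivA : ((a K)%:R - 'X : {poly int})^`() = - 1.
  by rewrite derivB derivX -polyC_natr derivC sub0r.
have E1 : (P * ((a K)%:R - 'X))^`() = ((a K)%:R - 'X) * P^`() - P.
  by rewrite derivM derivA; ring.
exists (((a K)%:R - 'X) * Q - P^`()).
exists (((a K)%:R - S) * E - theta (zhorner S P^`() * theta (T 0%N) + theta S * zhorner S Q * T 0%N)
   + p%:R * theta E); split.
  by rewrite E1 derivB derivM derivA -QE; ring.
rewrite TS // E1 TK !(zhornerM, zhornerB, zhorner_nat, zhornerX) raddfD raddfB /=.
rewrite [theta (_ ^+ 2 * _)](_ : _ = p%:R ^+ 2 * theta E); last first.
  by rewrite -natrX theta_natM.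
rewrite (theta_natM p (_ + _)) thetaM theta_zhorner.
by ring.
Qed.

End FirstOrder.

(** * Falling factorial modulo p^2 and Bernoulli numbers *)

Section Falling.
Variables (p : nat) (p_prime : prime p).
Let p_gt0 : (0 < p)%N := prime_gt0 p_prime.
Let p_gt1 : (1 < p)%N := prime_gt1 p_prime.
Notation polyF := (map_poly (intr : int -> 'F_p)).

Lemma polyF_eq0 (P : {poly int}) : polyF P = 0 -> exists G, P = p%:R * G.
Proof.
move=> P0; exists (\poly_(i < size P) (P`_i %/ p)%Z); apply/polyP => i.
rewrite mulr_natl coefMn coef_poly; case: ltnP => [_|le]; last first.
  by rewrite nth_default // mul0rn.
have := congr1 (fun Q : {poly 'F_p} => Q`_i) P0.
rewrite coef0 coef_map /= => /eqP; rewrite intr_Fp_eq0 // => /divzK {1}<-.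
by rewrite -mulr_natr natz.
Qed.

Definition falling : {poly int} := \prod_(i < p) ('X - i%:R).

Lemma fallingE : falling = \prod_(i < p) ('X - i%:Z%:P).
Proof. by apply: eq_bigr => i _; rewrite -natz polyC_natr. Qed.

(** Both sides are monic of degree p and vanish on the whole of F_p. *)
Lemma polyF_falling : polyF falling = 'X^p - 'X.
Proof.
have sz : size ('X^p - 'X : {poly 'F_p}) = p.+1.
  by rewrite size_polyDl ?size_polyXn // size_polyN size_polyX ltnS.
have mon : ('X^p - 'X : {poly 'F_p}) \is monic.
  by rewrite monicE lead_coefDl ?lead_coefXn // size_polyXn size_polyN size_polyX ltnS.
(* The elements of F_p are listed as images of 0, ..., p - 1 to match the
   index range of the falling factorial. *)
pose rs := [seq (i%:R : 'F_p) | i <- iota 0 p].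
have := @all_roots_prod_XsubC _ ('X^p - 'X : {poly 'F_p}) rs.
rewrite sz size_map size_iota (monicP mon) scale1r => -> //.
- have iotaE : iota 0 p = index_iota 0 p by rewrite /index_iota subn0.
  rewrite /rs iotaE /falling rmorph_prod big_map big_mkord /=.
  apply: eq_bigr => i _; rewrite rmorphB /= map_polyX rmorph_nat.
  by rewrite polyC_natr.
- apply/allP => x _; rewrite /root !hornerE.
  by have := expf_card x; rewrite card_Fp // => ->; rewrite subrr.
- rewrite uniq_rootsE map_inj_in_uniq ?iota_uniq // => i j.
  rewrite !mem_iota !add0n /= => lti ltj.
  wlog leij : i j lti ltj / (i <= j)%N => [H e|e].
    by case/orP: (leq_total i j) => h; [apply: H|apply/esym; apply: H].
  have /eqP : (j - i)%N%:R = 0 :> 'F_p by rewrite natrB // e subrr.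
  by rewrite natr_Fp_eq0 // => /dvdn_leq; lia.
Qed.

(** The quotient G carries the Stirling numbers s(p, k)/p, whose residues are
    the numbers lambda. *)
Lemma falling_mod_p : exists G : {poly int}, falling = 'X^p - 'X + p%:R * G.
Proof.
have [|G GE] := @polyF_eq0 (falling - ('X^p - 'X)).
  by rewrite rmorphB rmorphB /= map_polyXn map_polyX polyF_falling subrr.
by exists G; rewrite -GE addrC subrK.
Qed.

Lemma falling_monic : falling \is monic.
Proof. by rewrite fallingE monic_prod_XsubC. Qed.

Lemma size_falling : size falling = p.+1.
Proof. by rewrite fallingE size_prod_XsubC /index_enum -enumT size_enum_ord. Qed.

(** Both sides are the product of x - i over 0 <= i <= p. *)
Lemma falling_shift : falling * ('X - p%:R) = 'X * (falling \Po ('X - 1)).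
Proof.
have -> : falling \Po ('X - 1) = \prod_(i < p) ('X - i.+1%:R).
  rewrite /falling rmorph_prod; apply: eq_bigr => i _.
  by rewrite /= rmorphB /= comp_polyX rmorph_nat -natr1; ring.
rewrite /falling -(big_mkord xpredT (fun i => 'X - i%:R)).
rewrite -(big_mkord xpredT (fun i => 'X - i.+1%:R)).
transitivity (\prod_(0 <= i < p.+1) ('X - i%:R) : {poly int}).
  by rewrite big_nat_recr.
by rewrite big_nat_recl // subr0.
Qed.

(** Upper negation: modulo p, p - 1 - i is -(i + 1). *)
Lemma bin_Fp_neg i r : (i + r < p)%N ->
  'C(p.-1 - i, r)%:R = (-1) ^+ r * 'C(i + r, r)%:R :> 'F_p.
Proof.
elim: i r => [|i IHi] r.
  rewrite subn0 add0n binn mulr1; elim: r => [|r IHr] ltr; first by rewrite bin0.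
  have : 'C(p, r.+1)%:R = 0 :> 'F_p.
    by apply/eqP; rewrite natr_Fp_eq0 // prime_dvd_bin.
  have -> : 'C(p, r.+1) = ('C(p.-1, r.+1) + 'C(p.-1, r))%N by rewrite -binS prednK.
  rewrite natrD IHr 1?ltnW // => /eqP.
  by rewrite addr_eq0 exprS mulN1r => /eqP.
elim: r => [|r IHr] ltr; first by rewrite !bin0 mul1r.
have e : (p.-1 - i)%N = (p.-1 - i.+1).+1 by lia.
have := IHi r.+1; rewrite e binS natrD IHr; last by lia.
rewrite addSn -addnS => H; have {H} := H (ltac:(lia)).
move/(canRL (addrK _)) => ->.
rewrite [in RHS]addSn binS natrD exprS -!addnS; ring.
Qed.

Lemma coef_natM (n : nat) (P : {poly int}) k : (n%:R * P)`_k = n%:R * P`_k.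
Proof. by rewrite !mulr_natl coefMn. Qed.

Lemma coef_XB1n j k : (('X - 1) ^+ j : {poly int})`_k = (-1) ^+ (j - k) * 'C(j, k)%:R.
Proof.
rewrite addrC exprDn coef_sum.
under eq_bigr => i _.
  rewrite coefMn -polyC1 -polyCN -rmorphXn coefCM coefXn.
  over.
case: (leqP k j) => [lekj|ltjk]; last first.
  rewrite bin_small // mulr0 big1 // => i _.
  by rewrite gtn_eqF ?mulr0 ?mul0rn // (leq_trans (ltn_ord i)).
have ltk : (k < j.+1)%N by [].
rewrite (bigD1 (Ordinal ltk)) //= eqxx mulr1 big1 ?addr0 => [|i].
  by rewrite mulr_natr.
by rewrite -val_eqE /= eq_sym => /negbTE ->; rewrite mulr0 mul0rn.
Qed.

Lemma coef_shift (P : {poly int}) k N : (size P <= N)%N ->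
  (P \Po ('X - 1))`_k = \sum_(j < N) P`_j * ((-1) ^+ (j - k) * 'C(j, k)%:R).
Proof.
move=> szP; rewrite coef_comp_poly.
under eq_bigr => j _ do rewrite coef_XB1n.
rewrite (big_ord_widen _ (fun j => P`_j * ((-1) ^+ (j - k) * 'C(j, k)%:R)) szP).
rewrite big_mkcond; apply: eq_bigr => j _; case: ltnP => // le.
by rewrite nth_default ?mul0r.
Qed.

Lemma bernoulli_top n :
  n.+1%:R * bernoulli n = (n == 0%N)%:R - \sum_(j < n) 'C(n.+1, j)%:R * bernoulli j.
Proof. by rewrite -bernoulli_rec big_ord_recr /= binSn addrC addrK. Qed.

(** In the recursion for B_n only n + 1 is divided by, and n + 1 < p. *)
Lemma bernoulli_pint n : (n.+1 < p)%N -> bernoulli n \in pint p.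
Proof.
elim/ltn_ind: n => n IHn ltn.
have n0 : n.+1%:R != 0 :> rat by rewrite pnatr_eq0.
rewrite -(mulKf n0 (bernoulli n)) bernoulli_top rpredM //.
  by rewrite pint_divn // gtnNdvd.
rewrite rpredB ?rpred_nat // rpred_sum // => j _.
by rewrite rpredM ?rpred_nat ?IHn //; apply: ltn_trans ltn; rewrite ltnS.
Qed.

(** Reduction of the Bernoulli numbers, meaningful for index at most p - 2. *)
Definition bernoulliF n : 'F_p := ratr (bernoulli n).

Lemma bernoulliF_rec n : (n.+1 < p)%N ->
  \sum_(j < n.+1) 'C(n.+1, j)%:R * bernoulliF j = (n == 0%N)%:R.
Proof.
move=> ltn; pose bz j : Zp p := insubd 0 (bernoulli j).
have bzE j : (j < n.+1)%N -> zval (bz j) = bernoulli j.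
  by move=> ltj; rewrite -[LHS]/(val _) insubdK // bernoulli_pint // (leq_trans _ ltn).
have E : \sum_(j < n.+1) 'C(n.+1, j)%:R * bz j = (n == 0%N)%:R.
  apply: val_inj; rewrite rmorph_sum rmorph_nat /= -bernoulli_rec.
  by apply: eq_bigr => j _; rewrite [LHS]zval_natM bzE.
rewrite -(rmorph_nat (red p_prime)) -E rmorph_sum; apply: eq_bigr => j _.
by rewrite rmorphM rmorph_nat /= /red -[val _]/(zval _) bzE.
Qed.

Lemma bernoulliF_uniq (h : nat -> 'F_p) : h 0 = 1 ->
  (forall n, (0 < n)%N -> (n.+1 < p)%N -> \sum_(j < n.+1) 'C(n.+1, j)%:R * h j = 0) ->
  forall n, (n.+1 < p)%N -> h n = bernoulliF n.
Proof.
move=> h0 hrec; elim/ltn_ind => n IHn ltn.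
have n0 : n.+1%:R != 0 :> 'F_p by rewrite natr_Fp_eq0 // gtnNdvd.
apply: (mulfI n0).
have E : \sum_(j < n.+1) 'C(n.+1, j)%:R * h j = \sum_(j < n.+1) 'C(n.+1, j)%:R * bernoulliF j.
  rewrite bernoulliF_rec //; case: (n) ltn => [|m] ltm; last by rewrite hrec.
  by rewrite big_ord1 bin0 mul1r h0.
move: E; rewrite big_ord_recr [RHS]big_ord_recr /= binSn.
rewrite (eq_bigr (fun j : 'I_n => 'C(n.+1, j)%:R * bernoulliF j)); first exact: addrI.
by move=> j _; rewrite IHn // (leq_ltn_trans _ ltn) // ltnS ltnW.
Qed.

Section FallingQuo.
Variables (G : {poly int}) (GE : falling = 'X^p - 'X + p%:R * G).
Let g k : 'F_p := (G`_k)%:~R.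

Lemma falling_coef k : falling`_k = (k == p)%:R - (k == 1%N)%:R + p%:R * G`_k.
Proof. by rewrite GE coefD coefB coefXn coefX !mulr_natl coefMn. Qed.

Lemma natz_p_neq0 : p%:R != 0 :> int. Proof. by rewrite pnatr_eq0 -lt0n. Qed.

Lemma falling_quo_size k : (p <= k)%N -> G`_k = 0.
Proof.
move=> lepk; apply: (mulfI natz_p_neq0); rewrite mulr0.
have := falling_coef k; have -> : (k == 1%N) = false by lia.
rewrite subr0; move: lepk; rewrite leq_eqVlt => /orP[/eqP <-|ltpk].
  have := monicP falling_monic; rewrite /lead_coef size_falling /= => ->.
  by rewrite eqxx => /eqP; rewrite -subr_eq0 opprD addNKr oppr_eq0 => /eqP.
by rewrite nth_default ?size_falling // gtn_eqF // add0r.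
Qed.

Lemma falling_quo_coef0 : G`_0 = 0.
Proof.
apply: (mulfI natz_p_neq0); rewrite mulr0; have := falling_coef 0.
have -> : falling`_0 = 0.
  rewrite -horner_coef0 /falling horner_prod; apply/eqP/prodf_eq0.
  by exists (Ordinal p_gt0) => //; rewrite subr0 hornerX.
by rewrite ltn_eqF // subrr add0r.
Qed.

(** The identity x (F(x) - F(x-1)) = p F(x) for F = x^p - x + p G. The
    difference x^p - (x-1)^p - 1 is divisible by p, so the coefficients of this
    identity can be divided by p. *)
Lemma falling_quo_shift :
  'X * ('X^p - ('X - 1) ^+ p - 1 + p%:R * (G - (G \Po ('X - 1)))) = p%:R * falling.
Proof.
have -> : p%:R * falling = 'X * (falling - (falling \Po ('X - 1))).
  by rewrite [RHS]mulrBr -falling_shift; ring.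
rewrite GE comp_polyD comp_polyB comp_polyM comp_polyX comp_Xn_poly; congr ('X * _).
have -> : p%:R \Po ('X - 1) = p%:R :> {poly int} by rewrite -polyC_natr comp_polyC.
by ring.
Qed.

(** Coefficient of x^(k+1) in the preceding identity, multiplied by k so that k
    C(p, k) = p C(p-1, k-1) makes the division by p explicit. *)
Lemma falling_quo_rec_int k : (1 <= k)%N -> (k < p)%N ->
  k%:R * (G`_k - \sum_(j < p) G`_j * ((-1) ^+ (j - k) * 'C(j, k)%:R)) -
    (-1) ^+ (p - k) * 'C(p.-1, k.-1)%:R = k%:R * falling`_k.+1.
Proof.
move=> k1 ltkp; apply: (mulfI natz_p_neq0).
have := congr1 (fun P : {poly int} => P`_k.+1) falling_quo_shift.
rewrite coefXM /= coefD !coef_natM !coefB coefXn ltn_eqF // coef1.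
rewrite gtn_eqF // coef_XB1n (@coef_shift _ _ p); last by apply/leq_sizeP => j; apply: falling_quo_size.
set A := G`_k - _.
have kb : (k%:R * 'C(p, k)%:R = p%:R * 'C(p.-1, k.-1)%:R :> int).
  by rewrite -!natrM mul_bin_diag prednK.
move=> E.
rewrite [RHS]mulrCA -E; move: kb; set e := (-1) ^+ (p - k).
set c := 'C(p, k)%:R; set c' := 'C(p.-1, k.-1)%:R => kb.
transitivity (k%:R * (p%:R * A) - e * (p%:R * c')); first by ring.
by rewrite -kb; ring.
Qed.

Variable p_odd : odd p.

Lemma falling_coef1 : falling`_1 = ((p.-1)`!)%:R.
Proof.
rewrite /falling; case: p p_odd => // q /= q_even; rewrite big_ord_recl subr0 coefXM /=.
rewrite -horner_coef0 horner_prod.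
under eq_bigr => i _ do rewrite /bump leq0n add1n hornerD hornerN hornerX -polyC_natr hornerC sub0r -mulN1r.
rewrite big_split /= prodr_const card_ord -signr_odd (negbTE q_even) mul1r.
by rewrite -natr_prod fact_prod big_add1 big_mkord.
Qed.

(** The linear coefficient of the falling factorial is (p-1)!, hence the Wilson
    quotient. *)
Lemma falling_quo_wilson : g 1 = wilson_quotient p.
Proof.
have := falling_coef 1; rewrite falling_coef1 ltn_eqF // eqxx sub0r => E.
rewrite /g /wilson_quotient subn1.
(* The Wilson quotient is a quotient of natural numbers, so the sign of the
   integer coefficient has to be settled first. *)
have [m mE] : exists m : nat, G`_1 = m.
  case GE1: (G`_1) E => [m|m] E; first by exists m.
  by move: E; rewrite NegzE natz; nia.
rewrite mE -pmulrn; congr _%:R.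
have -> : ((p.-1)`! + 1 = m * p)%N by move: E; rewrite mE natz; lia.
by rewrite mulnK.
Qed.

(** Reduction modulo p, where C(p-1, k-1) is a sign and the falling factorial
    has no term of degree strictly between 1 and p. *)
Lemma falling_quo_rec k : (1 <= k)%N -> (k.+1 < p)%N ->
  \sum_(k.+1 <= j < p) (-1) ^+ (j - k) * 'C(j.-1, k.-1)%:R * (j%:R * g j) = -1.
Proof.
move=> k1 ltkp; have ltkp' := ltnW ltkp.
have := congr1 (fun z : int => z%:~R : 'F_p) (falling_quo_rec_int k1 ltkp').
rewrite falling_coef [(_ == p)]ltn_eqF // [(_ == 1%N)]gtn_eqF // subrr add0r.
rewrite rmorphB !rmorphM !rmorph_nat /= (pcharf0 (pchar_Fp p_prime)) mul0r mulr0.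
rewrite rmorphB rmorph_sum rmorphXn rmorphN1 /=.
have -> : 'C(p.-1, k.-1)%:R = (-1) ^+ k.-1 :> 'F_p.
  by have := @bin_Fp_neg 0 k.-1; rewrite subn0 add0n binn mulr1 => -> //; lia.
rewrite -exprD -signr_odd.
have -> : odd (p - k + k.-1) = false by lia.
rewrite expr0 -(big_mkord xpredT (fun j => (G`_j * ((-1) ^+ (j - k) * 'C(j, k)%:R))%:~R : 'F_p)).
rewrite (@big_cat_nat _ _ _ k) //= 1?ltnW //.
rewrite big1_seq ?add0r; last first.
  by move=> j /=; rewrite mem_index_iota => /andP[_ lt]; rewrite bin_small // !mulr0.
rewrite big_ltn // subnn binn expr0 !mulr1 opprD addNKr.
move/eqP; rewrite subr_eq0 mulrN => /eqP/(canRL (@opprK _)) H; rewrite -[RHS]H.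
rewrite mulr_sumr; apply: eq_big_nat => j /andP[ltkj _].
rewrite !rmorphM /= rmorphXn rmorphN1 !rmorph_nat /= -/(g j).
have jk : j%:R * 'C(j.-1, k.-1)%:R = k%:R * 'C(j, k)%:R :> 'F_p.
  by rewrite -!natrM mul_bin_diag prednK.
set e := (-1) ^+ (j - k).
transitivity (e * g j * (j%:R * 'C(j.-1, k.-1)%:R)); first by ring.
by rewrite jk; ring.
Qed.

(** With h_0 = 1 and h_i = (p - i) g_(p-i), the recursion above becomes the
    defining recursion of the Bernoulli numbers, because (-1)^(p-i-k) C(p-1-i,
    k-1) is C(p-k, i) modulo p. Hence d g_d = B_(p-d). *)
Lemma falling_quo_lambda d : (1 <= d)%N -> (d < p)%N -> g d = lambda_ p d.
Proof.
rewrite /lambda_ => d1 ltdp; case: eqP => [->|/eqP dn1]; first exact: falling_quo_wilson.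
have d0 : d%:R != 0 :> 'F_p by rewrite natr_Fp_eq0 // gtnNdvd.
apply: (mulfI d0); rewrite mulrC [RHS]mulrC divfK //.
pose h i := if i == 0%N then 1 else (p - i)%:R * g (p - i).
have -> : g d * d%:R = h (p - d)%N.
  by rewrite /h ifN -?lt0n ?subn_gt0 // subKn 1?ltnW // mulrC.
apply: bernoulliF_uniq => //; last by lia.
move=> n n_gt0 ltn; pose k := (p - n.+1)%N.
have := @falling_quo_rec k; rewrite -[k.+1]add1n big_addn.
have -> : (p - k)%N = n.+1 by rewrite subKn // ltnW.
move=> H; have {H} := H (ltac:(lia)) (ltac:(lia)).
rewrite big_nat_rev /= => H.
rewrite -(big_mkord xpredT (fun j => 'C(n.+1, j)%:R * h j)) big_ltn // bin0 mul1r.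
apply/eqP; rewrite addrC addr_eq0 -H; apply/eqP; apply: eq_big_nat => i /andP[i1 ltin].
have e1 : (1 + n.+1 - i.+1 + k = p - i)%N by lia.
rewrite e1 /h ifN -?lt0n //; congr (_ * _).
have e2 : (p - i - k = n.+1 - i)%N by lia.
have e3 : ((p - i).-1 = p.-1 - i)%N by lia.
have e4 : (k.-1 = (p.-1 - i) - (n.+1 - i))%N by lia.
rewrite e2 e3 e4 bin_sub; last by lia.
rewrite bin_Fp_neg; last by lia.
rewrite mulrA -exprD -signr_odd addnn odd_double expr0 mul1r subnKC; last by lia.
by rewrite bin_sub // ltnW.
Qed.

End FallingQuo.
End Falling.

(** * Coefficients of powers of the p-power series *)

Section Coefs.
Variables (p : nat) (p_prime : prime p).
Let p_gt0 : (0 < p)%N := prime_gt0 p_prime.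
Let p_gt1 : (1 < p)%N := prime_gt1 p_prime.
Notation S := (Spow 'F_p p).
Notation redF := (fmap (red p_prime)).

(** Dissection by residues: t^j f(t^p) lives on the residue class of j. *)
Lemma fcoefXn_dil (R : comNzRingType) j (f : fps R) n : (j < p)%N ->
  (fX ^+ j * fdil p f) n = if (n %% p == j)%N then f (n %/ p)%N else 0.
Proof.
move=> ltjp; rewrite fcoefXnM /=; case: leqP => [lejn|ltnj]; last first.
  by rewrite modn_small ?ltn_eqF // (ltn_trans ltnj).
rewrite -eqn_mod_dvd // (modn_small ltjp); case: eqP => // nj.
by congr (f _); rewrite {1}(divn_eq n p) nj addnK mulnK.
Qed.

Lemma fsec_decomp (R : comNzRingType) (f : fps R) : f = \sum_(j < p) fX ^+ j * fdil p (fsec p j f).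
Proof.
apply: fpsP => n; rewrite fcoef_sum.
under eq_bigr => j _ do rewrite fcoefXn_dil //.
rewrite (bigD1 (Ordinal (ltn_pmod n p_gt0))) //= eqxx big1 ?addr0 => [|j].
  by rewrite -divn_eq.
by rewrite -val_eqE /= eq_sym => /negbTE ->.
Qed.

Lemma digitS n i : digit p n i.+1 = digit p (n %/ p) i.
Proof. by rewrite /digit expnS divnMA. Qed.

Lemma digit_small n i : (n < i)%N -> digit p n i = 0%N.
Proof.
move=> lt; rewrite /digit divn_small ?mod0n //.
exact: ltn_trans lt (ltn_expl _ p_gt1).
Qed.

Lemma digit_sum_widen n N : (n < N)%N -> (\sum_(i < N) digit p n i)%N = digit_sum p n.
Proof.
move=> lt; rewrite /digit_sum -(subnKC lt) big_split_ord /= [X in (_ + X)%N]big1 ?addn0 //.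
by move=> i _; rewrite digit_small // ltnS leq_addr.
Qed.

Lemma digit_fact_widen n N : (n < N)%N ->
  \prod_(i < N) ((digit p n i)`!)%:R = digit_fact p n.
Proof.
move=> lt; rewrite /digit_fact -(subnKC lt) big_split_ord /= [X in _ * X]big1 ?mulr1 //.
by move=> i _; rewrite digit_small // ltnS leq_addr.
Qed.

Lemma digit_sum0 : digit_sum p 0 = 0%N.
Proof. by rewrite /digit_sum big_ord1 /digit div0n mod0n. Qed.

Lemma digit_fact0 : digit_fact p 0 = 1.
Proof. by rewrite /digit_fact big_ord1 /digit div0n mod0n. Qed.

Lemma digit_sumE n : (0 < n)%N -> digit_sum p n = (n %% p + digit_sum p (n %/ p))%N.
Proof.
move=> n_gt0; rewrite /digit_sum big_ord_recl /= {1}/digit expn0 divn1.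
rewrite (eq_bigr (fun i : 'I_n => digit p (n %/ p) i)) => [|i _]; last first.
  by rewrite /bump leq0n add1n digitS.
by rewrite digit_sum_widen // ltn_Pdiv.
Qed.

Lemma digit_factE n : (0 < n)%N ->
  digit_fact p n = ((n %% p)`!)%:R * digit_fact p (n %/ p).
Proof.
move=> n_gt0; rewrite /digit_fact big_ord_recl /= {1}/digit expn0 divn1.
rewrite (eq_bigr (fun i : 'I_n => ((digit p (n %/ p) i)`!)%:R)) => [|i _]; last first.
  by rewrite /bump leq0n add1n digitS.
by rewrite digit_fact_widen // ltn_Pdiv.
Qed.

Lemma fact_Fp_neq0 j : (j < p)%N -> (j`!)%:R != 0 :> 'F_p.
Proof.
elim: j => [|j IHj] ltj; first by rewrite oner_neq0.
by rewrite factS natrM mulf_neq0 ?IHj ?natr_Fp_eq0 ?gtnNdvd // ltnW.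
Qed.

Lemma digit_fact_neq0 n : digit_fact p n != 0.
Proof. by apply/prodf_neq0 => i _; rewrite fact_Fp_neq0 // ltn_pmod. Qed.

Lemma Fp_Wilson : ((p.-1)`!)%:R = -1 :> 'F_p.
Proof.
apply/eqP; rewrite -addr_eq0 natr1 natr_Fp_eq0 //.
by rewrite -Wilson.
Qed.

(** Binomial expansion of (t + S(t^p))^d; it lets coefficients be computed digit
    by digit. *)
Lemma Spow_exp_dil (R : comNzRingType) d :
  Spow R p ^+ d = \sum_(j < d.+1) 'C(d, j)%:R * (fX ^+ j * fdil p (Spow R p ^+ (d - j))).
Proof.
rewrite {1}SpowE // addrC exprDn; apply: eq_bigr => j _.
by rewrite fdilXn // mulr_natl mulrC.
Qed.

(** For d < p only the term with j the lowest digit of n contributes to degree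
    n, so the multinomial coefficient builds up along the digits without
    carries. *)
Lemma coef_Spow_exp d n : (d < p)%N ->
  (S ^+ d) n = if digit_sum p n == d then (d`!)%:R / digit_fact p n else 0.
Proof.
elim/ltn_ind: n d => n IHn d ltdp.
case: (posnP n) => [->|n_gt0].
  rewrite digit_sum0 digit_fact0 divr1 eq_sym; case: eqP => [->|/eqP d0].
    by rewrite expr0.
  by rewrite fcoefXn_small ?Spow0 // lt0n.
rewrite Spow_exp_dil fcoef_sum digit_sumE // digit_factE //.
under eq_bigr => j _.
  rewrite fcoef_natM fcoefXn_dil; last by apply: leq_ltn_trans ltdp; rewrite -ltnS.
  over.
case: (leqP (n %% p) d) => [ler|ltr]; last first.
  rewrite big1 => [|j _]; first by rewrite ifN //; lia.
  by rewrite ifN ?mulr0 //; have := ltn_ord j; lia.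
have ltr : (n %% p < d.+1)%N by [].
rewrite (bigD1 (Ordinal ltr)) //= eqxx big1 ?addr0 => [|j]; last first.
  by rewrite -val_eqE /= eq_sym => /negbTE ->; rewrite mulr0.
rewrite IHn ?ltn_Pdiv //; last by apply: leq_ltn_trans ltdp; apply: leq_subr.
have -> : (digit_sum p (n %/ p) == d - n %% p)%N = (n %% p + digit_sum p (n %/ p) == d)%N by lia.
case: ifP => _; last by rewrite mulr0.
rewrite -(bin_fact ler) !natrM.
have h1 := digit_fact_neq0 (n %/ p).
have h2 : ((n %% p)`!)%:R != 0 :> 'F_p by rewrite fact_Fp_neq0 // ltn_pmod.
by field; rewrite h1 h2.
Qed.

Lemma carry_exists : exists D, Spow (Zp p) p ^+ p = fdil p (Spow (Zp p) p) + p%:R * D.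
Proof.
have [|D DE] := @fmap_red_eq0 p p_prime (Spow (Zp p) p ^+ p - fdil p (Spow (Zp p) p)).
  by rewrite rmorphB rmorphXn /= fmap_fdil fmap_Spow fps_Frobenius // subrr.
by exists D; rewrite -DE addrC subrK.
Qed.

Section Carry.
Variables (D : fps (Zp p)) (DE : Spow (Zp p) p ^+ p = fdil p (Spow (Zp p) p) + p%:R * D).

(** Digit recursion for D. In the expansion of (t + S(t^p))^p the extreme terms
    reproduce S(t^p) and p D(t^p), and the others have binomial coefficients
    divisible by p. *)
Lemma carry_rec : D = fdil p D + \sum_(1 <= j < p)
  ('C(p, j) %/ p)%:R * (fX ^+ j * fdil p (Spow (Zp p) p ^+ (p - j))).
Proof.
apply: (fpmul_inj p_prime); rewrite mulrDr mulr_sumr.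
have := Spow_exp_dil (Zp p) p.
rewrite -(big_mkord xpredT (fun j => 'C(p, j)%:R * (fX ^+ j * fdil p (Spow (Zp p) p ^+ (p - j))))).
rewrite big_nat_recr // big_ltn // subnn bin0 binn subn0 expr0 !mul1r fdil1 mulr1 /=.
rewrite DE [fdil p (_ + _)]raddfD /= fdilM // => E.
have fp : fdil p p%:R = p%:R :> fps (Zp p) by rewrite [LHS]raddfMn /= fdil1.
rewrite fp in E.
have -> : p%:R * D = fdil p (fdil p (Spow (Zp p) p)) + fX ^+ p - fdil p (Spow (Zp p) p)
   + p%:R * fdil p D + \sum_(1 <= i < p) 'C(p, i)%:R * (fX ^+ i * fdil p (Spow (Zp p) p ^+ (p - i))).
  by move/(canRL (addKr _)): E => ->; ring.
rewrite -fdilX // {2}(SpowE (Zp p) p_gt1) raddfD /=.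
set T := \sum_(1 <= i < p) _; set T' := \sum_(1 <= i < p) _.
have -> : T = T'.
  apply: eq_big_nat => j /andP[j1 ltj]; rewrite [RHS]mulrA; congr (_ * _).
  by rewrite -natrM mulnC divnK // prime_dvd_bin // j1.
by ring.
Qed.

Lemma carry_rec_red : redF D = fdil p (redF D) + \sum_(1 <= j < p)
  ('C(p, j) %/ p)%:R * (fX ^+ j * fdil p (S ^+ (p - j))).
Proof.
rewrite {1}carry_rec rmorphD rmorph_sum /= fmap_fdil; congr (_ + _).
apply: eq_bigr => j _.
by rewrite !rmorphM rmorph_nat rmorphXn /= fmapX fmap_fdil rmorphXn /= fmap_Spow.
Qed.

(** Digit by digit, the carry behaves like the divided power S^p/p! without its
    terms t^(p^i), and (p-1)! = -1. *)
Lemma carry_coef n :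
  redF D n = if digit_sum p n == p then - 1 / digit_fact p n else 0.
Proof.
elim/ltn_ind: n => n IHn; case: (posnP n) => [->|n_gt0].
  rewrite digit_sum0 ltn_eqF //.
  (* Degree 0 is its own quotient by p, so the recursion says nothing there. *)
  have D0 : D 0%N = 0.
    apply: (pmul_inj p_prime); rewrite mulr0 -fcoef_natM.
    have -> : p%:R * D = Spow (Zp p) p ^+ p - fdil p (Spow (Zp p) p) by rewrite DE addrC addKr.
    by rewrite fcoefD fcoefXn_small ?Spow0 // fcoefN -[0%N](mul0n p) fcoef_dil_mul // Spow0 subr0.
  by rewrite /= D0 rmorph0.
rewrite carry_rec_red fcoefD fcoef_sum -[fdil p _]mul1r -(expr0 fX) fcoefXn_dil //.
under eq_big_nat => j /andP[_ ltj].
  rewrite fcoef_natM fcoefXn_dil //.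
  over.
rewrite digit_sumE // digit_factE //; case: (posnP (n %% p)) => [r0|r_gt0].
  rewrite r0 big_nat_cond big1 ?addr0 => [|j]; last first.
    by rewrite andbT => /andP[j1 _]; rewrite ltn_eqF // mulr0.
  by rewrite IHn ?ltn_Pdiv // add0n fact0 mul1r.
rewrite add0r (bigD1_seq (n %% p)%N) ?mem_index_iota ?iota_uniq ?r_gt0 ?ltn_pmod //.
rewrite eqxx big1 ?addr0 => [|j /negbTE]; last by rewrite eq_sym => ->; rewrite mulr0.
set r := (n %% p)%N in r_gt0 *.
have ltrp : (r < p)%N by rewrite ltn_pmod.
rewrite coef_Spow_exp; last by rewrite ltn_subrL r_gt0.
have -> : (digit_sum p (n %/ p) == p - r)%N = (r + digit_sum p (n %/ p) == p)%N by lia.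
rewrite [LHS]/= addr0; case: ifP => _; last by rewrite mulr0.
(* C(p, r) r! (p - r)! = p!, divided by p. *)
have c : ('C(p, r) %/ p)%:R * (r`!)%:R * ((p - r)`!)%:R = -1 :> 'F_p.
  rewrite -Fp_Wilson -!natrM; congr _%:R; apply/eqP.
  rewrite -(eqn_pmul2l p_gt0) -{5}(prednK p_gt0) -factS prednK //.
  rewrite -(bin_fact (ltnW ltrp)) !mulnA [(p * _)%N]mulnC divnK //.
  by rewrite prime_dvd_bin // r_gt0.
have h1 := digit_fact_neq0 (n %/ p).
have h2 := fact_Fp_neq0 ltrp.
rewrite -[in RHS]c; by field; rewrite h1 h2.
Qed.

End Carry.

Lemma Spow_Fp : S ^+ p = S - fX.
Proof. by rewrite fps_Frobenius // {2}SpowE // addrC addKr. Qed.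

(** Lagrange inversion for S = t + S^p: S^(r+1) = t S^r + S^(r+p) matches the
    Pascal rule for C(pq + r, q). The base case needs C(pq, q) = 0 for q > 0,
    which holds modulo p. *)
Lemma coef_Spow_Lagrange m r : (S ^+ r) (r + m)%N =
  if (p.-1 %| m)%N then 'C(p * (m %/ p.-1) + r, m %/ p.-1)%:R else 0.
Proof.
have p1 : (0 < p.-1)%N by lia.
elim/ltn_ind: m r => m IHm; elim=> [|r IHr].
  rewrite expr0 add0n fcoef1 addn0; case: (posnP m) => [->|m_gt0].
    by rewrite dvdn0 div0n bin0.
  case: ifP => // /dvdnP[q qE].
  have q_gt0 : (0 < q)%N by move: m_gt0; rewrite qE muln_gt0 => /andP[].
  rewrite qE mulnK //; apply/esym/eqP; rewrite natr_Fp_eq0 //.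
  have : (q * 'C(p * q, q) = q * (p * 'C((p * q).-1, q.-1)))%N.
    rewrite mulnA [(q * p)%N]mulnC -{2}(prednK q_gt0) mul_bin_diag prednK //.
  by move/eqP; rewrite eqn_pmul2l // => /eqP ->; rewrite dvdn_mulr.
have -> : S ^+ r.+1 = fX * S ^+ r + S ^+ (r + p).
  by rewrite [S ^+ (r + p)]exprD Spow_Fp exprS; ring.
rewrite fcoefD addSn fcoefXM IHr; case: (ltnP m p.-1) => [ltm|lem].
  rewrite [X in _ + X]fcoefXn_small ?Spow0 //; last by lia.
  rewrite addr0; case: ifP => // /dvdnP[q qE].
  have -> : m = 0%N by move: ltm; rewrite qE; case: (q) => // q'; rewrite mulSn; lia.
  by rewrite div0n !bin0.
have -> : (r + m).+1 = ((r + p) + (m - p.-1))%N by lia.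
rewrite IHm; last by lia.
rewrite dvdn_subl //; case: ifP => [/dvdnP[q qE]|]; last by rewrite addr0.
have q_gt0 : (0 < q)%N by move: lem; rewrite qE; case: (q) => //; lia.
have mq : (m - p.-1 = (q - 1) * p.-1)%N by rewrite qE mulnBl mul1n.
rewrite mq qE !mulnK // subn1.
rewrite -natrD; congr _%:R; case: (q) q_gt0 => // q' _ /=.
by rewrite addnS binS; congr (_ + 'C(_, _))%N; rewrite mulnS; lia.
Qed.

Lemma one_sub_Spow : 1 - S ^+ p.-1 = fdil p.-1 (Fps (delta_ p)).
Proof.
have p1 : (0 < p.-1)%N by lia.
apply: fpsP => n; rewrite fcoefD fcoefN fcoef1 /=.
case: (ltnP n p.-1) => [lt|le].
  rewrite fcoefXn_small ?Spow0 // subr0; case: (posnP n) => [->|n_gt0].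
    by rewrite dvdn0 div0n.
  by rewrite ifN ?gtn_eqF // gtnNdvd.
rewrite -{2}(subnKC le) coef_Spow_Lagrange dvdn_subl // gtn_eqF ?(leq_trans p1) // sub0r.
case: ifP => [/dvdnP[m mE]|]; last by rewrite oppr0.
have m_gt0 : (0 < m)%N by move: le; rewrite mE; case: (m) => //; lia.
have mq : (n - p.-1 = (m - 1) * p.-1)%N by rewrite mE mulnBl mul1n.
rewrite mq mE !mulnK // /delta_ gtn_eqF //; congr (- _%:R).
by congr 'C(_, _); rewrite mulnBr muln1; nia.
Qed.

(** * Lucas' congruence *)

Lemma coef_1X_exp (R : comNzRingType) n k : ((1 + fX) ^+ n : fps R) k = 'C(n, k)%:R.
Proof.
elim: n k => [|n IHn] k; first by rewrite expr0 fcoef1 bin0n.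
rewrite exprS mulrDl mul1r fcoefD IHn fcoefXM.
by case: k => [|k]; rewrite ?bin0 ?addr0 // IHn binS natrD.
Qed.

(** Compare coefficients in (1 + t)^(ap+b) = (1 + t^p)^a (1 + t)^b. *)
Lemma bin_Lucas_step a b c d : (b < p)%N -> (d < p)%N ->
  'C(a * p + b, c * p + d)%:R = 'C(a, c)%:R * 'C(b, d)%:R :> 'F_p.
Proof.
move=> ltb ltd.
rewrite -!coef_1X_exp exprD mulnC exprM fps_Frobenius // -fdilXn // fcoef_dilM //.
rewrite divnMDl // divn_small // addn0 big_ord_recr [LHS]/= addnC mulnC addnK.
rewrite big1 ?add0r // => m _; rewrite !coef_1X_exp [X in _ * X%:R]bin_small ?mulr0 //.
have := ltn_ord m; nia.
Qed.

Lemma bin_Lucas N (al be : nat -> nat) :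
  (forall i, (al i < p)%N) -> (forall i, (be i < p)%N) ->
  'C(\sum_(i < N) al i * p ^ i, \sum_(i < N) be i * p ^ i)%:R =
    \prod_(i < N) 'C(al i, be i)%:R :> 'F_p.
Proof.
elim: N al be => [|N IHN] al be hal hbe; first by rewrite !big_ord0 bin0.
have split (g : nat -> nat) :
    (\sum_(i < N.+1) g i * p ^ i = (\sum_(i < N) g i.+1 * p ^ i) * p + g 0)%N.
  rewrite big_ord_recl expn0 muln1 addnC big_distrl; congr (_ + _)%N.
  by apply: eq_bigr => i _; rewrite lift0 expnSr mulnA.
rewrite !split bin_Lucas_step // (IHN (fun i => al i.+1) (fun i => be i.+1)) //.
by rewrite big_ord_recl mulrC.
Qed.

(** The digits of pm - 1 = p (m - 1) + (p - 1) are those of m - 1 shifted by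
    one, with p - 1 in front. *)
Lemma delta_Lucas m N (alpha : nat -> nat) : (1 <= m)%N ->
  (forall i, (alpha i < p)%N) -> (forall i, (N <= i)%N -> alpha i = 0%N) ->
  (m - 1)%N = (\sum_(i < N) alpha i * p ^ i)%N ->
  delta_ p m = - ('C(p - 1, alpha 0%N)%:R * \prod_(i < N) 'C(alpha i, alpha i.+1)%:R).
Proof.
move=> m_gt0 lt_al al0 mE; rewrite /delta_ gtn_eqF //; congr (- _).
pose be i := if i is j.+1 then alpha j else (p - 1)%N.
have e1 : (p * m - 1 = \sum_(i < N.+1) be i * p ^ i)%N.
  rewrite big_ord_recl expn0 muln1 /=.
  under eq_bigr => i _ do rewrite /bump leq0n add1n /= expnSr mulnA.
  rewrite -big_distrl /= -mE mulnBl mul1n; nia.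
have e2 : (m - 1 = \sum_(i < N.+1) alpha i * p ^ i)%N.
  by rewrite big_ord_recr /= al0 // mul0n addn0.
rewrite e1 e2 bin_Lucas //; last by case=> [|i] //=; lia.
by rewrite big_ord_recl.
Qed.

Lemma delta_eq0 m N (alpha : nat -> nat) : (1 <= m)%N ->
  (forall i, (alpha i < p)%N) -> (forall i, (N <= i)%N -> alpha i = 0%N) ->
  (m - 1)%N = (\sum_(i < N) alpha i * p ^ i)%N ->
  ~ (forall i, (alpha i.+1 <= alpha i)%N) -> delta_ p m = 0.
Proof.
move=> m_gt0 lt_al al0 mE nmon; rewrite (delta_Lucas m_gt0 lt_al al0 mE).
have [i lti] : exists i, (alpha i < alpha i.+1)%N.
  apply: contrapT => H; apply: nmon => i; rewrite leqNgt; apply/negP => lti.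
  by apply: H; exists i.
have ltiN : (i < N)%N.
  by rewrite ltnNge; apply/negP => le; move: lti; rewrite (al0 i.+1) // leqW.
by rewrite (bigD1 (Ordinal ltiN)) //= (bin_small lti) mul0r mulr0 oppr0.
Qed.

End Coefs.

(** * The section at zero of the Artin--Hasse exponential modulo p *)

Section SectionsMod.
Variables (p : nat) (p_prime : prime p).
Let p_gt0 : (0 < p)%N := prime_gt0 p_prime.
Let p_gt1 : (1 < p)%N := prime_gt1 p_prime.
Notation S := (Spow 'F_p p).
Notation Sz := (Spow (Zp p) p).
Notation redF := (fmap (red p_prime)).
Let zv : {rmorphism Zp p -> rat} := \val.

Definition AHz : fps (Zp p) := Fps (fun n => MkZp (AH_pint p_prime n)).

Lemma AHz_val : fmap zv AHz = AH p.
Proof. exact: fpsP. Qed.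

Lemma fmap_zv_inj : injective (fmap zv).
Proof.
move=> f g fg; apply: fpsP => n; apply: val_inj.
exact: (congr1 (fun h => fcoef h n) fg).
Qed.

Lemma theta_AHz : theta AHz = Sz * AHz.
Proof.
apply: fmap_zv_inj; rewrite fmap_theta AHz_val theta_AH // rmorphM /=.
by rewrite fmap_Spow AHz_val.
Qed.

Definition AHz_sec j := fsec p j AHz.
Notation U := AHz_sec.

(** The component of theta E = (x + S(x^p)) E along the residue j + 1. *)
Lemma AHz_sec_rec j : (j.+1 < p)%N -> U j = (j.+1%:R - Sz) * U j.+1 + p%:R * theta (U j.+1).
Proof.
move=> ltj; have := congr1 (fsec p j.+1) theta_AHz.
rewrite fsec_theta {1}SpowE // mulrDl fsecD fsecXM fsec_dilM // -/(U j.+1) -/(U j) => E.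
apply: (@addIr _ (Sz * U j.+1)); rewrite -E; ring.
Qed.

(** The component along the residue 0, where the factor x wraps around. *)
Lemma AHz_sec_rec0 : fX * U p.-1 = (0%:R - Sz) * U 0 + p%:R * theta (U 0).
Proof.
have := congr1 (fsec p 0) theta_AHz.
rewrite fsec_theta {1}SpowE // mulrDl fsecD fsec0XM // fsec_dilM // -/(U 0) -/(U _) => E.
apply: (@addIr _ (Sz * U 0)); rewrite -E; ring.
Qed.

Definition AH_sec j : fps 'F_p := redF (U j).
Notation A := AH_sec.
Notation V := (A p.-1).

Lemma AH_sec_coef j n : A j n = a_ p (n * p + j)%N.
Proof. by []. Qed.

Lemma AH_sec_red j : redF (U j) = A j.
Proof. by []. Qed.

Lemma fsec_red_AHz j : fsec p j (redF AHz) = A j.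
Proof. exact: fpsP. Qed.

Lemma AH_sec_rec j : (j.+1 < p)%N -> A j = (j.+1%:R - S) * A j.+1.
Proof.
move=> ltj; rewrite {1}/AH_sec AHz_sec_rec // rmorphD !rmorphM rmorphB !rmorph_nat /=.
by rewrite fps_Fp_pchar // mul0r addr0 fmap_Spow.
Qed.

Opaque AH_sec AHz_sec AHz.

Lemma AH_sec_prod j : (j < p)%N -> A j = \prod_(j.+1 <= i < p) (i%:R - S) * V.
Proof.
move=> ltj; have [m mE] : exists m, (j + m)%N = p.-1 by exists (p.-1 - j)%N; lia.
elim: m j ltj mE => [|m IHm] j ltj jm.
  have -> : j = p.-1 by lia.
  by rewrite prednK // big_geq // mul1r.
have ltj1 : (j.+1 < p)%N by lia.
by rewrite AH_sec_rec // IHm //; [rewrite (big_ltn ltj1) mulrA | lia].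
Qed.

Variable p_odd : odd p.

Lemma AHz_fneg : AHz * fneg AHz = 1.
Proof.
by apply: fmap_zv_inj; rewrite rmorphM rmorph1 /= fmap_fneg AHz_val AH_fneg.
Qed.

(** Indexed from 1, this is the cofactor of X in the falling factorial; p is
    odd, so its even number of factors can be written as i - X. *)
Definition facprod : {poly int} := \prod_(1 <= i < p) (i%:R - 'X).

Lemma prod_sub_falling : \prod_(i < p) (i%:R - 'X) = - falling p.
Proof.
rewrite /falling -[RHS]mulN1r -[X in X * _]expr1.
have -> : (-1) ^+ 1 = \prod_(i < p) (-1) :> {poly int}.
  by rewrite prodr_const card_ord -[RHS]signr_odd p_odd.
by rewrite -big_split; apply: eq_bigr => i _ /=; ring.
Qed.

Lemma falling_facprod : falling p = 'X * facprod.
Proof.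
apply: oppr_inj; rewrite -prod_sub_falling -(big_mkord xpredT (fun i => i%:R - 'X)).
by rewrite big_ltn // sub0r mulNr.
Qed.

Lemma facprod_Fp : exists G, facprod = 'X^(p.-1) - 1 + p%:R * G.
Proof.
have [|G GE] := @polyF_eq0 p p_prime (facprod - ('X^(p.-1) - 1)).
  apply: (@mulfI _ 'X); first by rewrite polyX_eq0.
  have := polyF_falling p_prime; rewrite falling_facprod rmorphM /= map_polyX => E.
  rewrite mulr0 rmorphB rmorphB rmorph1 /= map_polyXn.
  rewrite mulrBr E; apply/eqP; rewrite subr_eq0; apply/eqP.
  by rewrite mulrBr mulr1 -exprS prednK.
by exists G; rewrite -GE addrC subrK.
Qed.

Lemma zhorner_pM (s : fps 'F_p) P : zhorner s (p%:R * P) = 0.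
Proof. by rewrite zhornerM zhorner_nat fps_Fp_pchar // mul0r. Qed.

Lemma zhorner_facprod (s : fps 'F_p) : zhorner s facprod = s ^+ p.-1 - 1.
Proof.
have [G ->] := facprod_Fp.
by rewrite zhornerD zhorner_pM addr0 zhornerB zhornerXn zhorner1.
Qed.

(** The sum of the products with one factor missing is minus the derivative of
    X^(p-1) - 1, and p - 1 = -1 modulo p. *)
Lemma prod_skip_sum (s : fps 'F_p) :
  \sum_(1 <= j < p) (\prod_(1 <= i < j) (i%:R - s) * \prod_(j.+1 <= i < p) (i%:R - s))
   = s ^+ p.-2.
Proof.
have := congr1 (zhorner s) (deriv_prod_nat (fun i => i%:R - 'X) (ltnW p_gt1)).
rewrite -/facprod; have [G ->] := facprod_Fp.
rewrite derivD derivB derivXn derivC subr0 derivM -polyC_natr derivC mul0r add0r polyC_natr.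
rewrite zhornerD zhorner_pM addr0 -mulr_natl zhornerM zhorner_nat zhornerXn.
have -> : p.-1%:R = -1 :> fps 'F_p.
  by apply/eqP; rewrite -addr_eq0 natr1 prednK // fps_Fp_pchar.
rewrite mulN1r zhorner_sum => E; apply: oppr_inj; rewrite E -sumrN.
apply: eq_bigr => j _; rewrite !zhornerM !zhorner_prod derivB derivX -polyC_natr derivC sub0r zhornerN zhorner1.
by rewrite mulrN1 mulNr; congr (- (_ * _)); apply: eq_bigr => i _; rewrite zhornerB zhornerX zhorner_nat.
Qed.

Lemma fsec0_fXn_fneg j (f : fps 'F_p) : (0 < j < p)%N ->
  fsec p 0 (fX ^+ j * fneg f) = (-1) ^+ (p - j) * (fX * fneg (fsec p (p - j) f)).
Proof.
move=> /andP[j0 ltj]; apply: fpsP => -[|n].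
  rewrite [LHS]/= fcoefXnM leqNgt addn0 mul0n j0 fcoefM big_ord_recl big_ord0 addr0 fcoefXM.
  by rewrite mulr0.
rewrite [LHS]/= fcoefXnM addn0.
have le : (j <= n.+1 * p)%N by rewrite mulSn; lia.
have e : (n.+1 * p - j = n * p + (p - j))%N by rewrite mulSn; lia.
rewrite le e mulrCA fcoefXM /= exprD mulrAC.
have -> : (-1) ^+ (n * p) = (-1) ^+ n :> 'F_p.
  by rewrite -signr_odd oddM p_odd andbT signr_odd.
rewrite -[_ ^+ _ in RHS]/((-1) ^+ (p - j) : fps 'F_p).
have -> : (-1) ^+ (p - j) = ((-1) ^+ (p - j))%:~R :> fps 'F_p.
  by rewrite rmorphXn rmorphN1.
by rewrite mulrzl fcoefMz -mulrzl rmorphXn rmorphN1 /=; ring.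
Qed.

(** The component of E(x) E(-x) = 1 along the residue 0: the section j of E
    pairs with the section p - j of E(-x). *)
Lemma AH_fneg_sec0 :
  1 = A 0 * fneg (A 0) +
      \sum_(1 <= j < p) A j * ((-1) ^+ (p - j) * (fX * fneg (A (p - j)))).
Proof.
have E : redF AHz * fneg (redF AHz) = 1 by rewrite -fmap_fneg -rmorphM AHz_fneg rmorph1.
have s1 : fsec p 0 1 = 1 :> fps 'F_p.
  by apply: fpsP => n; rewrite /= addn0 muln_eq0 [(p == _)]gtn_eqF // orbF.
rewrite -[LHS]s1 -[X in fsec p 0 X = _]E {1}(fsec_decomp p_prime (redF AHz)) mulr_suml.
have -> : fsec p 0 (\sum_(i < p) fX ^+ i * fdil p (fsec p i (redF AHz)) * fneg (redF AHz)) =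
   \sum_(i < p) A i * fsec p 0 (fX ^+ i * fneg (redF AHz)).
  transitivity (\sum_(i < p) fsec p 0 (fX ^+ i * fdil p (fsec p i (redF AHz)) * fneg (redF AHz))).
    by apply: fpsP => n; rewrite [LHS]/= !fcoef_sum.
  apply: eq_bigr => i _; rewrite [fX ^+ i * _]mulrC -mulrA fsec_dilM // fsec_red_AHz.
rewrite -(big_mkord xpredT (fun i => A i * fsec p 0 (fX ^+ i * fneg (redF AHz)))) big_ltn //.
congr (_ + _).
  rewrite expr0 mul1r -fsec_red_AHz; congr (_ * _); apply: fpsP => n.
  by rewrite /= !addn0 -signr_odd oddM p_odd andbT signr_odd.
apply: eq_big_nat => j j1; rewrite fsec0_fXn_fneg // fsec_red_AHz.
Qed.

Lemma fneg_prod a b : fneg (\prod_(a <= i < b) (i%:R - S)) = \prod_(a <= i < b) (i%:R + S).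
Proof.
rewrite rmorph_prod; apply: eq_bigr => i _.
by rewrite rmorphB rmorph_nat /= fneg_Spow // opprK.
Qed.

(** Modulo p, i + S = - ((p - i) - S). *)
Lemma reflect_prod j : (0 < j < p)%N ->
  \prod_((p - j).+1 <= i < p) (i%:R + S) = (-1) ^+ j.-1 * \prod_(1 <= i < j) (i%:R - S).
Proof.
move=> /andP[j0 ltj].
have -> : (-1) ^+ j.-1 = \prod_(1 <= i < j) (-1) :> fps 'F_p.
  by rewrite prodr_const_nat subn1.
rewrite -big_split /= big_nat_rev /=.
rewrite -{1}[(p - j).+1]add1n big_addn.
have -> : (p - (p - j) = j)%N by lia.
apply: eq_big_nat => i /andP[i1 lti].
have -> : ((p - j).+1 + p - (i + (p - j)).+1 = p - i)%N by lia.
by rewrite natrB ?fps_Fp_pchar //; [ring | lia].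
Qed.

Lemma fX_Spow : fX = S - S ^+ p.
Proof. by rewrite Spow_Fp //; ring. Qed.

Lemma AH_sec0E : A 0 = (S ^+ p.-1 - 1) * V.
Proof.
rewrite AH_sec_prod // -zhorner_facprod zhorner_prod; congr (_ * _).
by apply: eq_bigr => i _; rewrite zhornerB zhorner_nat zhornerX.
Qed.

Lemma pm1_even : (-1) ^+ p.-1 = 1 :> fps 'F_p.
Proof. by rewrite -signr_odd; have -> : odd p.-1 = false by lia. Qed.

Lemma fneg_AH_sec0E : fneg (A 0) = (S ^+ p.-1 - 1) * fneg V.
Proof.
by rewrite AH_sec0E rmorphM rmorphB rmorphXn rmorph1 /= (fneg_Spow _ p_odd) exprNn pm1_even mul1r.
Qed.

(** In the preceding identity every product A_j(t) A_(p-j)(-t) is V(t) V(-t)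
    times the product of all i - S with i <> j. Their sum over j is S^(p-2), and
    t = S - S^p. *)
Lemma AH_sec_last_fneg : V * fneg V * (1 - S ^+ p.-1) = 1.
Proof.
have := AH_fneg_sec0; rewrite fneg_AH_sec0E AH_sec0E.
have -> : \sum_(1 <= j < p) A j * ((-1) ^+ (p - j) * (fX * fneg (A (p - j)))) =
   fX * (V * fneg V) * S ^+ p.-2.
  rewrite -prod_skip_sum mulr_sumr; apply: eq_big_nat => j /andP[j1 ltj].
  rewrite (AH_sec_prod ltj) (@AH_sec_prod (p - j)); last by lia.
  rewrite rmorphM /= fneg_prod reflect_prod ?j1 //.
  have sg : (-1) ^+ (p - j) * (-1) ^+ j.-1 = 1 :> fps 'F_p.
    by rewrite -exprD -[RHS]pm1_even; congr (_ ^+ _); lia.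
  transitivity ((-1) ^+ (p - j) * (-1) ^+ j.-1 * (fX * (V * fneg V) *
    (\prod_(1 <= i < j) (i%:R - S) * \prod_(j.+1 <= i < p) (i%:R - S)))); last by rewrite sg mul1r.
  by ring.
rewrite fX_Spow.
have -> : S ^+ p = S ^+ p.-2 * S * S by rewrite -!exprSr; congr (_ ^+ _); lia.
have -> : S ^+ p.-1 = S ^+ p.-2 * S by rewrite -exprSr; congr (_ ^+ _); lia.
by move=> {2}->; ring.
Qed.

End SectionsMod.

(** * The logarithmic derivative and the theorem *)

Section Final.
Variables (p : nat) (p_prime : prime p) (p_odd : odd p).
Let p_gt0 : (0 < p)%N := prime_gt0 p_prime.
Let p_gt1 : (1 < p)%N := prime_gt1 p_prime.
Notation S := (Spow 'F_p p).
Notation Sz := (Spow (Zp p) p).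
Notation redF := (fmap (red p_prime)).
Notation U := (AHz_sec p_prime).
Notation A := (AH_sec p_prime).
Notation V := (A p.-1).

Lemma fps_Fp_double0 (f : fps 'F_p) : f + f = 0 -> f = 0.
Proof.
move=> ff; apply: fpsP => n; have /eqP := congr1 (fun h => fcoef h n) ff.
rewrite /= -mulr2n -mulr_natl mulf_eq0 natr_Fp_eq0 // => /orP[|/eqP //].
by rewrite gtnNdvd //; lia.
Qed.

(** The p relations between sections are chained starting from the last section,
    T_k = U_(p-1-k), and end with T_p = t U_(p-1). In the first order expansion
    everything is divisible by p, and after division P is y - y^p modulo p,
    whose first derivative is 1 and whose second derivative is 0. *)
Lemma theta_AH_sec_last (G : {poly int}) (D : fps (Zp p)) :
  falling p = 'X^p - 'X + p%:R * G -> Sz ^+ p = fdil p Sz + p%:R * D ->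
  theta V = - (redF D + zhorner S G) * V.
Proof.
move=> GE DE.
pose T k := if (k < p)%N then U (p.-1 - k) else fX * U p.-1.
have T0 : T 0%N = U p.-1 by rewrite /T p_gt0 subn0.
have Tp : T p = fX * U p.-1 by rewrite /T ltnn.
have Trec k : (k < p)%N -> T k.+1 = ((p.-1 - k)%:R - Sz) * T k + p%:R * theta (T k).
  move=> ltk; rewrite /T ltk; case: (ltnP k.+1 p) => [ltk1|lek1].
    have -> : (p.-1 - k = (p.-1 - k.+1).+1)%N by lia.
    by rewrite AHz_sec_rec //; lia.
  have -> : (p.-1 - k = 0)%N by lia.
  by rewrite AHz_sec_rec0.
have [Q [E [QE]]] := first_order_expansion Trec.
have PE : \prod_(i < p) ((p.-1 - i)%:R - 'X) = - falling p.
  rewrite -prod_sub_falling // (reindex_inj rev_ord_inj) /=.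
  by apply: eq_bigr => i _; congr (_%:R - _); have := ltn_ord i; lia.
rewrite {}PE in QE *; rewrite Tp T0 => TE.
have hzF : zhorner Sz (- falling p) = fX - p%:R * (D + zhorner Sz G).
  by rewrite zhornerN GE zhornerD zhornerB zhornerM zhorner_nat zhornerXn zhornerX DE {2}(SpowE (Zp p) p_gt1); ring.
rewrite hzF in TE.
set P' := zhorner Sz _^`() in TE; set Q' := zhorner Sz Q in TE.
have E1 : (D + zhorner Sz G) * U p.-1 + P' * theta (U p.-1) + theta Sz * Q' * U p.-1 = p%:R * E.
  apply: (fpmul_inj p_prime) => /=; apply/eqP; rewrite -subr_eq0; apply/eqP.
  transitivity (fX * U p.-1 - ((fX - p%:R * (D + zhorner Sz G)) * U p.-1
    - p%:R * (P' * theta (U p.-1) + theta Sz * Q' * U p.-1) + p%:R ^+ 2 * E)); first by ring.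
  by rewrite -TE subrr.
have redP : redF P' = 1.
  rewrite /P' rmorph_zhorner /= fmap_Spow GE derivN derivD derivB derivXn derivX derivM.
  rewrite -polyC_natr derivC mul0r add0r polyC_natr zhornerN zhornerD zhorner_pM // addr0 zhornerB zhorner1.
  by rewrite -mulr_natl zhorner_pM // sub0r opprK.
have redQ : redF Q' = 0.
  apply: fps_Fp_double0; rewrite /Q' -rmorphD -zhornerD QE rmorph_zhorner /= fmap_Spow GE.
  rewrite derivN derivD derivB derivXn derivX derivM -[p%:R]polyC_natr derivC mul0r add0r polyC_natr.
  rewrite derivN !derivD derivN derivC oppr0 addr0.
  rewrite -mulr_natl !derivM -[p%:R]polyC_natr derivC !mul0r !add0r polyC_natr.
  by rewrite -mulrDr zhornerN zhorner_pM // oppr0.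
have := congr1 redF E1.
rewrite !rmorphD !rmorphM !rmorphD /= rmorph_nat fps_Fp_pchar // mul0r redP redQ.
rewrite mulr0 mul0r addr0 mul1r fmap_theta AH_sec_red rmorph_zhorner /= fmap_Spow => /eqP.
by rewrite addr_eq0 mulNr eq_sym eqr_oppLR => /eqP ->.
Qed.

Lemma W_coef k : W_ p k = (A 0 * theta (fneg (A 0))) k.
Proof.
rewrite mulrC fcoefM; apply: eq_bigr => i _.
rewrite -[fcoef (theta _) _]/((i : nat)%:R * ((-1) ^+ i * A 0 i)) !AH_sec_coef !addn0.
by rewrite !mulrA [_%:R * _]mulrC.
Qed.

(** Differentiate A_0(t) A_0(-t) = 1 - S^(p-1), using A_0 = (S^(p-1) - 1) V and
    theta(S) = t modulo p. *)
Lemma W_series (G : {poly int}) (D : fps (Zp p)) :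
  falling p = 'X^p - 'X + p%:R * G -> Sz ^+ p = fdil p Sz + p%:R * D ->
  A 0 * theta (fneg (A 0)) = (1 - S ^+ p.-1) * (redF D + zhorner S G).
Proof.
move=> GE DE; have thV := theta_AH_sec_last GE DE; have VV := AH_sec_last_fneg p_prime p_odd.
set R := redF D + zhorner S G in thV *.
have A0 := AH_sec0E p_prime p_odd; have B0 := fneg_AH_sec0E p_prime p_odd.
have thS : theta S = fX by rewrite theta_Spow // fps_Fp_pchar // mul0r addr0.
(* From here on only q = S^(p-1) and x = t S^(p-2) matter. *)
have thq : theta (S ^+ p.-1) = - (S ^+ p.-2 * fX).
  rewrite thetaXn thS; have -> : p.-1%:R = -1 :> fps 'F_p.
    by apply/eqP; rewrite -addr_eq0 natr1 prednK // fps_Fp_pchar.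
  by rewrite mulN1r mulNr.
move: (S ^+ p.-1) (S ^+ p.-2 * fX) thq VV A0 B0 => q x thq VV A0 B0.
move: (fneg V) (fneg (A 0)) VV A0 B0 => Vm A0m VV A0 B0.
have AA : A 0 * A0m = 1 - q.
  rewrite A0 B0; transitivity ((1 - q) * (V * Vm * (1 - q))); first by ring.
  by rewrite VV mulr1.
have thA0 : theta (A 0) = - (x + (q - 1) * R) * V.
  by rewrite A0 thetaM raddfB /= theta1 thq thV; ring.
have -> : A 0 * theta A0m = x - theta (A 0) * A0m.
  have := congr1 (@theta _) AA; rewrite thetaM raddfB /= theta1 thq sub0r opprK => <-.
  by rewrite [X in X - _]addrC addrK.
rewrite thA0 B0; transitivity (x - (x + (q - 1) * R) * (V * Vm * (1 - q))); first by ring.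
by rewrite VV mulr1; ring.
Qed.

(** The three cases in the definition of rho are the supports of the powers S^d
    with d < p, of D, and the complement. *)
Lemma rho_coef (G : {poly int}) (D : fps (Zp p)) n :
  falling p = 'X^p - 'X + p%:R * G -> Sz ^+ p = fdil p Sz + p%:R * D ->
  (redF D + zhorner S G) n = rho_ p n.
Proof.
move=> GE DE; rewrite fcoefD (carry_coef p_prime DE) /rho_.
have -> : (zhorner S G) n = \sum_(1 <= d < p) lambda_ p d * (S ^+ d) n.
  rewrite /zhorner (@horner_coef_wide _ p); last first.
    apply: leq_trans (size_poly _ _) _; apply/leq_sizeP => k.
    exact: (falling_quo_size p_prime GE).
  rewrite fcoef_sum -(big_mkord xpredT (fun i => ((map_poly intr G)`_i * S ^+ i) n)).
  rewrite big_ltn // coef_map /= (falling_quo_coef0 p_prime GE) mul0r add0r.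
  apply: eq_big_nat => d /andP[d1 ltd].
  by rewrite coef_map /= -(falling_quo_lambda p_prime GE p_odd d1 ltd) mulrzl fcoefMz mulrzl.
set s := digit_sum p n; case: (posnP n) => [n0|n_gt0].
  rewrite /s n0 digit_sum0 // ltn_eqF // add0r big_nat_cond big1 // => d.
  rewrite andbT => /andP[d1 _]; rewrite fcoefXn_small ?mulr0 //; exact: Spow0.
under eq_big_nat => d /andP[_ ltd].
  rewrite coef_Spow_exp // -/s.
  over.
have sp : (s <= p - 1)%N = (s < p)%N by lia.
rewrite sp; case: (ltnP 0 s) => [s_gt0|s_le0]; case: (ltnP s p) => [lts|les] /=.
- rewrite ltn_eqF // add0r (bigD1_seq s) ?mem_index_iota ?iota_uniq ?s_gt0 //=.
  rewrite eqxx big1 ?addr0 ?mulrA // => d /negbTE.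
  by rewrite eq_sym => ->; rewrite mulr0.
- rewrite [X in _ + X]big_nat_cond [X in _ + X]big1 ?addr0 // => d.
  by rewrite andbT => /andP[_ ltd]; rewrite gtn_eqF ?mulr0 // (leq_trans ltd).
- rewrite [X in _ + X]big_nat_cond [X in _ + X]big1 ?addr0 // => d.
  by rewrite andbT => /andP[d1 ltd]; rewrite ltn_eqF ?mulr0 // (leq_ltn_trans s_le0).
- by lia.
Qed.

Lemma W_formula k :
  W_ p k = \sum_(m < (k %/ (p - 1)).+1) delta_ p m * rho_ p (k - m * (p - 1))%N.
Proof.
have [G GE] := falling_mod_p p_prime; have [D DE] := carry_exists p_prime.
rewrite W_coef (W_series GE DE) one_sub_Spow // subn1 fcoef_dilM; last by lia.
by apply: eq_bigr => m _; rewrite (rho_coef _ GE DE).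
Qed.

End Final.

(* A base-p expansion is a sequence alpha of digits vanishing from some index *)
(* N on; the factors of the binomial product of index i >= N are 'C(0, 0) = 1. *)
Theorem theorem1p2 (p : nat) (p_prime : prime p) (p_odd : odd p) :
  (forall k : nat,
     W_ p k =
       \sum_(m < (k %/ (p - 1)).+1) delta_ p m * rho_ p (k - m * (p - 1))%N)
  /\
  (forall (m N : nat) (alpha : nat -> nat),
     (1 <= m)%N ->
     (forall i : nat, (alpha i < p)%N) ->
     (forall i : nat, (N <= i)%N -> alpha i = 0%N) ->
     (m - 1)%N = (\sum_(i < N) alpha i * p ^ i)%N ->
     delta_ p m =
       - ('C(p - 1, alpha 0%N)%:R
            * \prod_(i < N) 'C(alpha i, alpha i.+1)%:R)
     /\
     (~ (forall i : nat, (alpha i.+1 <= alpha i)%N) -> delta_ p m = 0)).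
Proof.
split=> [k|m N alpha m_gt0 lt_al al0 mE]; first exact: W_formula.
by split; [exact: (delta_Lucas p_prime) | exact: (delta_eq0 p_prime m_gt0 lt_al al0 mE)].
Qed.
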